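(* Let $\gamma<1$ be a real number. Then: (1) there exists a field $L\subset\overline{\mathbb{Q}}$ with $I_N(L)=I_B(L)=[\gamma,\infty)$; (2) for every real number $c>0$ there exists a field $L\subset\overline{\mathbb{Q}}$ with $I_N(L)=(\gamma,\infty)\subsetneq[\gamma,\infty)=I_B(L)$ and $\mathrm{Nor}_\gamma(L)=c$; (3) there exists a field $L\subset\overline{\mathbb{Q}}$ with $I_N(L)=I_B(L)=(\gamma,\infty)$.
   Context: $h:\overline{\mathbb{Q}}\to\mathbb{R}_{\ge0}$ is the absolute logarithmic Weil height, $\deg(a):=[\mathbb{Q}(a):\mathbb{Q}]$, and for $\gamma\in\mathbb{R}$ the $\gamma$-weighted Weil height is $h_\gamma(a):=\deg(a)^\gamma h(a)$. For $A\subset\overline{\mathbb{Q}}$ and $C>0$, $N_\gamma(A,C):=\#\{a\in A: h_\gamma(a)<C\}$, and $\mu_A$ is the set of roots of unity in $A$. $A$ has the $\gamma$-Northcott property ($\gamma$-(N)) if $N_\gamma(A,C)<\infty$ for all $C>0$; $A$ has the $\gamma$-Bogomolov property ($\gamma$-(B)) if $N_\gamma(A\setminus\mu_A,C)<\infty$ for some $C>0$. The $\gamma$-Northcott number is $\mathrm{Nor}_\gamma(A):=\inf\{C>0: N_\gamma(A,C)=\infty\}$ (with $\inf\emptyset=\infty$). Finally $I_N(A):=\{\gamma\in\mathbb{R}: A\text{ has }\gamma\text{-(N)}\}$ and $I_B(A):=\{\gamma\in\mathbb{R}: A\text{ has }\gamma\text{-(B)}\}$. *)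

(* Defs.v *)
From mathcomp Require Import all_boot all_order all_algebra all_field.
From mathcomp Require Import all_classical all_reals all_analysis.

Set Implicit Arguments.
Unset Strict Implicit.
Unset Printing Implicit Defensive.

Import Order.TTheory GRing.Theory Num.Theory.

Local Open Scope classical_set_scope.
Local Open Scope ring_scope.

(* The algebraic closure of the rationals is the type algC; a subset A of it is
   a term A : set algC, and a subfield is a set closed under 1, -, and /. *)
Definition subfield (L : set algC) : Prop := divring_closed [in L].

Definition deg (a : algC) : nat := (size (minCpoly a)).-1.

(* zcontents p carries the sign of lead_coef p, so zcontents p = 1 means that p
   is primitive with positive leading coefficient. *)
Definition is_int_minpoly (a : algC) (p : {poly int}) : Prop :=
  zcontents p = 1 /\ map_poly intr p = (lead_coef p)%:~R *: minCpoly a.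

Definition int_minpoly (a : algC) : {poly int} := xget 0 (is_int_minpoly a).

Lemma int_minpolyP (a : algC) : is_int_minpoly a (int_minpoly a).
Proof.
rewrite /int_minpoly; case: xgetP => [p //|] /= H; exfalso.
have [q [Dq mq] _] := minCpolyP a.
have [r [c nzc Dr]] := rat_poly_scale q.
have nzr : r != 0.
  apply/eqP => r0; move: mq; rewrite Dr r0 map_poly0 scaler0.
  by move/monic_neq0; rewrite eqxx.
apply: (H (zprimitive r)); split; first by rewrite zcontents_primitive nzr.
set p := zprimitive r.
have Dp : r = zcontents r *: p by rewrite -zpolyEprim.
have [d Dd] : exists d : algC, minCpoly a = d *: map_poly intr p.
  exists (ratr (c%:~R^-1 * (zcontents r)%:~R)).
  rewrite Dq Dr map_polyZ -map_poly_comp [in LHS]Dp map_polyZ /= scalerA.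
  congr (_ *: _); first by rewrite [RHS]rmorphM.
  by apply: eq_map_poly => x /=; rewrite rmorph_int.
have /monicP := minCpoly_monic a; rewrite Dd lead_coefZ => dl.
rewrite scalerA -(lead_coef_map_inj (f := intr : int -> algC)) //;
  last exact: intr_inj.
by rewrite mulrC dl scale1r.
Qed.

Lemma int_minpoly_unique (a : algC) (p q : {poly int}) :
  is_int_minpoly a p -> is_int_minpoly a q -> p = q.
Proof.
move=> [cp Dp] [cq Dq].
have lpos (s : {poly int}) : zcontents s = 1 -> lead_coef s != 0.
  by move=> cs; rewrite lead_coef_eq0 -zcontents_eq0 cs.
have E : lead_coef q *: p = lead_coef p *: q.
  apply: (map_inj_poly (f := intr : int -> algC)) => //; first exact: intr_inj.
  rewrite !map_polyZ /= Dp Dq !scalerA; congr (_ *: _); exact: mulrC.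
move: (congr1 zcontents E); rewrite !zcontentsZ cp cq !mulr1 => El.
move: E; rewrite El -!mul_polyC; apply: mulfI.
by rewrite polyC_eq0; apply: lpos.
Qed.

Section Heights.
Variable R : realType.

(* The modulus of z, transported from the real algebraic numbers to R through
   the Dedekind cut of its rational lower bounds. *)
Definition modulus (z : algC) : R :=
  sup [set ratr q | q in [set q : rat | ratr q <= `|z|]].

Definition mahler (p : {poly int}) : R :=
  (`|lead_coef p|)%:~R *
  \prod_(z <- sval (closed_field_poly_normal (map_poly intr p : {poly algC})))
     Num.max 1 (modulus z).

(* Absolute logarithmic Weil height: the product over the places of Q(a)
   defining exp (deg a * h a) is the Mahler measure of the primitive integral
   minimal polynomial of a, the finite places contributing its leading
   coefficient and the infinite ones max(1, |z|) for each conjugate z. *)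
Definition height (a : algC) : R := ln (mahler (int_minpoly a)) / (deg a)%:R.

Definition wheight (gamma : R) (a : algC) : R :=
  (deg a)%:R `^ gamma * height a.

(* N_gamma(A, C) is the cardinality of this set. *)
Definition small_height (gamma : R) (A : set algC) (C : R) : set algC :=
  [set a | A a /\ wheight gamma a < C].

Definition roots_of_unity (A : set algC) : set algC :=
  [set a | A a /\ exists2 n : nat, (0 < n)%N & n.-unity_root a].

Definition northcott (gamma : R) (A : set algC) : Prop :=
  forall C : R, 0 < C -> finite_set (small_height gamma A C).

Definition bogomolov (gamma : R) (A : set algC) : Prop :=
  exists2 C : R, 0 < C &
    finite_set (small_height gamma (A `\` roots_of_unity A) C).

(* ereal_inf set0 = +oo *)
Definition northcott_number (gamma : R) (A : set algC) : \bar R :=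
  ereal_inf [set C%:E | C in
    [set C : R | 0 < C /\ infinite_set (small_height gamma A C)]].

Definition I_N (A : set algC) : set R := [set gamma | northcott gamma A].

Definition I_B (A : set algC) : set R := [set gamma | bogomolov gamma A].

End Heights.

(* Main.v *)
From HB Require Import structures.
Require Import Defs.
From mathcomp Require Import all_boot all_order all_algebra all_field.
From mathcomp Require Import all_classical all_reals all_analysis.
From mathcomp Require Import perm ring lra zify.

Set Implicit Arguments.
Unset Strict Implicit.
Unset Printing Implicit Defensive.

Import Order.TTheory GRing.Theory Num.Theory.

Local Open Scope classical_set_scope.
Local Open Scope ring_scope.

(** The field is the union of a tower [Q = M_0 < M_1 < ...], where [M_(n+1)] is
    obtained from [M_n] by adjoining an [l]-th root [x] of [p / q], with [l], [p], [q]
    primes chosen at each step, [l > [M_n : Q]] and [p], [q] much larger.  As the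
    degrees are coprime, [M_n = Q(y)] for a single radical [y^D = rho].

    Lower bound.  Let [a] be in [M_(n+1)] but not in [M_n], [d = [M_n : Q]].  The norm to
    [Q] of the discriminant of [a] over [M_n], cleared of denominators by a power of the
    leading coefficient of the integral minimal polynomial of [a], is a nonzero integer
    divisible by [(p q)^(d (l - 1))]; the Leibniz expansion of a Vandermonde determinant
    bounds it by [l^(2 d (l - 1))] times a power of the Mahler measure.  This is Silverman's
    inequality [h(a) >= (ln p + ln q) / (2 l) - ln l / l].  When [p] and [q] have about the
    same logarithm and [ln l] is negligible against it, the bound is asymptotically
    [ln p / l = h(x)], hence sharp.

    For [gamma >= 0] the [gamma]-weighted height of new elements is thus at least about
    [l^gamma ln p / l], attained by [x]; for [gamma < 0] it is at least about
    [(d l)^gamma ln p / l], attained asymptotically by the generator [y] of [M_(n+1)].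
    Since [gamma < 1] one can choose [p], [q] so that this quantity is asymptotic to
    [ln l], to [c], or to [1 / ln l], which gives the three parts. *)

(** * Rationality and algebraic integers *)

(** Two primes are adjoined at each step because one is not sharp: for the [l]-th root of a single
    prime [p] the discriminant only yields [ln p / (2 l)], half of the true height [ln p / l]. With
    [p / q] both primes ramify while the height sees only the larger one, so the bound is sharp once
    [ln q] is close to [ln p]; a Northcott number exactly [c] depends on this.

    Order of choice: [l] comes first, then a target [T] with weight times [T / l] equal to the
    prescribed quantity, then [p] and [q] with logarithms in [[T, (1 + e) T]]. Since [gamma < 1],
    [T] exceeds a positive power of [l], which beats the error [ln l]. The primes are needed only up
    to this logarithmic precision, so central binomial coefficients provide them.

    The local argument uses no place above [p], only the ring of [x] such that [s x] is an algebraic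
    integer for some [s] prime to [p]. Rationality is invariance under all automorphisms of [algC].
    All estimates are made in [algC] and carried to [R] afterwards. *)

Lemma minCpoly_irreducible (x : algC) (p : {poly rat}) :
  minCpoly x = map_poly ratr p -> irreducible_poly p.
Proof.
move=> Dp; have [q [Dq mq] dvq] := minCpolyP x.
have {q Dq mq dvq} [mp dvp] : p \is monic /\
    (forall q : {poly rat}, root (map_poly ratr q) x = (p %| q)).
  have -> : p = q by apply: (map_poly_inj (ratr : rat -> algC)); rewrite -Dp.
  by [].
apply/(subfx_irreducibleP (iota := (ratr : rat -> algC)) (z := x)).
- by rewrite dvp.
- exact: monic_neq0.
- by move=> q; rewrite dvp => pq nzq; apply: dvdp_leq.
Qed.

(** The roots of the minimal polynomial generate a number field that is Galois over the rationals,
    and each of its automorphisms extends to [algC]; so [x] lies in the fixed field of the Galois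
    group, which is the prime field. *)
Lemma Crat_aut_fixed (x : algC) :
  (forall nu : {rmorphism algC -> algC}, nu x = x) -> x \in Crat.
Proof.
move=> fix_x; have [p [Dp mp] dvp] := minCpolyP x.
have irr_p := minCpoly_irreducible Dp.
have [r Dr] := closed_field_poly_normal (map_poly ratr p : {poly algC}).
rewrite lead_coef_map (monicP mp) rmorph1 scale1r in Dr.
have rx : x \in r by rewrite -root_prod_XsubC -Dr -Dp root_minCpoly.
have [Qr [QrC [rr Drr genQr]]] := num_field_exists r.
have {rx} [x1 Dx] : {x1 | QrC x1 = x}.
  by move: rx; rewrite -Drr => /mapP/sig2_eqW[x1]; exists x1.
pose pr := map_poly (in_alg Qr) p.
have prC : map_poly QrC pr = map_poly ratr p.
  rewrite -map_poly_comp; apply: eq_map_poly => a.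
  by rewrite /= rmorphZ_num rmorph1 mulr1.
have Qpr : pr \is a polyOver 1%VS.
  by apply/polyOverP=> i; rewrite coef_map memvZ ?memv_line.
have splitQr : splittingFieldFor 1 pr {:Qr}.
  exists rr => //; congr (_ %= _) : (eqpxx pr); apply/(map_poly_inj QrC).
  rewrite prC Dr -Drr big_map rmorph_prod /=; apply: eq_bigr => z _.
  by rewrite map_polyXsubC.
have Qr_ax : FieldExt_isSplittingField _ Qr by constructor; exists pr.
pose Sr := HB.pack_for (splittingFieldType rat) Qr Qr_ax.
have galS : galois (1%AS : {subfield Sr}) {:Sr}.
  apply/splitting_galoisField; exists pr; split => //.
  rewrite separable_map unlock irreducible_poly_coprime //.
  have [lt1p _] := irr_p.
  have szp : (0 < size p)%N by apply: leq_trans lt1p.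
  have nzp' : p^`() != 0.
    have [m szm] : exists m, size p = m.+2.
      by exists (size p).-2; rewrite -[LHS](subnKC lt1p) subn2.
    have lm : p`_m.+1 = 1 by have := monicP mp; rewrite lead_coefE szm.
    apply/eqP => p'0; have := coef_deriv p m; rewrite p'0 coef0 lm.
    by move=> /esym/eqP; rewrite pnatr_eq0.
  by rewrite gtNdvdp // lt_size_deriv // monic_neq0.
have := galois_fixedField galS => /(congr1 (fun V : {vspace _} => (x1 : Sr) \in V)).
have -> : ((x1 : Sr) \in fixedField 'Gal({:Sr} / 1%AS)%g) = true.
  apply/fixedFieldP; rewrite ?memvf // => g _.
  have [nu Dnu] := extend_algC_subfield_aut QrC (g : {rmorphism Sr -> Sr}).
  by apply: (fmorph_inj QrC); rewrite (Dnu x1) Dx fix_x.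
move=> /esym/vlineP[a Da]; rewrite -Dx Da rmorphZ_num rmorph1 mulr1.
exact: Crat_rat.
Qed.

Lemma Aint_integralOver (x : algC) :
  (x \in Aint) <-> integralOver (intr : int -> algC) x.
Proof.
split=> [/floorpP[p Dp] | [p mp px]].
  exists p; last by rewrite -Dp root_minCpoly.
  have := minCpoly_monic x; rewrite Dp !monicE lead_coef_map_inj //.
    by rewrite (_ : 1 = 1%:~R) // (inj_eq intr_inj).
  exact: intr_inj.
apply: (root_monic_Aint px); first exact: monic_map.
by apply/polyOverP => i; rewrite coef_map /= rpred_int.
Qed.

Lemma Aint_root_monic (p : {poly algC}) (x : algC) :
  p \is monic -> root p x -> p \is a polyOver Aint -> x \in Aint.
Proof.
move=> mp px Ap; apply/Aint_integralOver; apply: (integral_root_monic mp px).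
by move=> z zp; apply/Aint_integralOver; apply: (allP (polyOverS (fun _ => id) Ap)).
Qed.

Lemma Aint_exp_root (k : nat) (x : algC) : (0 < k)%N -> x ^+ k \in Aint -> x \in Aint.
Proof.
move=> k0 Axk; apply: (@Aint_root_monic ('X^k - (x ^+ k)%:P)).
- exact: monicXnsubC.
- by rewrite rootE !hornerE subrr.
- by rewrite rpredB ?polyOverC // rpredX // polyOverX.
Qed.

Lemma Aint_lead_root (p : {poly algC}) (x : algC) :
  p \is a polyOver Aint -> root p x -> lead_coef p * x \in Aint.
Proof.
move=> Ap px; have [->|nzp] := eqVneq p 0; first by rewrite lead_coef0 mul0r rpred0.
have [n szp] : exists n, size p = n.+1 by case: (size p) (size_poly_eq0 p) nzp => [<-//|n _ _]; exists n.
case: n szp => [|n] szp.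
  have := px; have /eqP/size_poly1P[c nzc ->] := szp.
  by rewrite rootC (negPf nzc).
set c := lead_coef p; have nzc : c != 0 by rewrite lead_coef_eq0.
(* With [p] of degree n+1, [q] is c^n p(X / c): monic, with integral coefficients and root c x. *)
pose q := \poly_(i < n.+2) (if i == n.+1 then 1 else p`_i * c ^+ (n - i)).
apply: (@Aint_root_monic q).
- rewrite monicE /q lead_coef_poly //= eqxx //; exact: oner_neq0.
- rewrite rootE /q horner_poly big_ord_recr /= eqxx mul1r.
  have /eqP := rootP px; rewrite horner_coef szp big_ord_recr /=.
  rewrite -[p`_n.+1]/(p`_(n.+2.-1)) -szp -lead_coefE -/c => /eqP H.
  have : c ^+ n * (\sum_(i < n.+1) p`_i * x ^+ i + c * x ^+ n.+1) = 0 by rewrite H mulr0.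
  rewrite mulrDr mulr_sumr => H'; apply/eqP; rewrite -[RHS]H'; congr (_ + _).
    apply: eq_bigr => i _; have lin : (i <= n)%N by rewrite -ltnS.
    rewrite ltn_eqF // exprMn.
    have -> : c ^+ n = c ^+ (n - i) * c ^+ i by rewrite -exprD subnK.
    by ring.
  by rewrite exprMn exprSr !mulrA.
- apply/polyOverP => i; rewrite coef_poly; case: ifP => // _; case: ifP => // _.
  by rewrite rpredM ?rpredX ?(polyOverP Ap) // /c lead_coefE (polyOverP Ap).
Qed.

(** Induction on the degree: the top term c X^m of [q] can be subtracted because c x is integral,
    [x] being a root of an integral polynomial with leading coefficient c. *)
Lemma Aint_poly_div_XsubC (q : {poly algC}) (x : algC) :
  q * ('X - x%:P) \is a polyOver Aint -> q \is a polyOver Aint.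
Proof.
have [n] := ubnP (size q); elim: n q => // n IHn q; rewrite ltnS => szq Aq.
have [->|nzq] := eqVneq q 0; first exact: polyOver0.
pose c := lead_coef q; pose m : {poly algC} := c *: 'X^((size q).-1).
have Ac : c \in Aint.
  have -> : c = lead_coef (q * ('X - x%:P)) by rewrite lead_coefM lead_coefXsubC mulr1.
  by rewrite lead_coefE (polyOverP Aq).
have Acx : c * x \in Aint.
  have -> : c = lead_coef (q * ('X - x%:P)) by rewrite lead_coefM lead_coefXsubC mulr1.
  by apply: Aint_lead_root => //; rewrite rootM root_XsubC eqxx orbT.
have Am : m \is a polyOver Aint by rewrite polyOverZ // rpredX // polyOverX.
have Amx : m * ('X - x%:P) \is a polyOver Aint.
  rewrite mulrBr /m -scalerAl -exprSr.
  rewrite rpredB ?polyOverZ ?rpredX ?polyOverX //.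
  by rewrite mulrC mul_polyC scalerA mulrC polyOverZ // rpredX // polyOverX.
rewrite -[q](subrK m) rpredD //; apply: IHn; last by rewrite mulrBl rpredB.
apply: leq_trans szq; rewrite -(prednK (n := size q)) ?lt0n ?size_poly_eq0 // ltnS.
apply/leq_sizeP => j; rewrite leq_eqVlt => /predU1P[<-|ltj].
  by rewrite coefB coefZ coefXn eqxx mulr1 /c lead_coefE subrr.
rewrite coefB coefZ coefXn gtn_eqF // mulr0 subr0 nth_default //.
by rewrite -(prednK (n := size q)) ?lt0n ?size_poly_eq0.
Qed.

(** The linear factors not selected by [b] are divided out one at a time; what remains has integral
    coefficients, and its constant coefficient is the product up to sign. Thus a single factor c
    clears the denominators of any product of distinct roots. *)
Lemma Aint_lead_prod_roots (T : Type) (c : algC) (s : seq T) (b : pred T) (F : T -> algC) :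
  c *: \prod_(i <- s) ('X - (F i)%:P) \is a polyOver Aint ->
  c * \prod_(i <- s | b i) F i \in Aint.
Proof.
move=> H; have : c *: \prod_(i <- s | b i) ('X - (F i)%:P) \is a polyOver Aint.
  move: H; rewrite (bigID b) /=; set g := \prod_(i <- s | b i) _.
  rewrite scalerAl; move: (c *: g) => {}g.
  elim: s => [|i s IHs]; first by rewrite big_nil mulr1.
  rewrite big_cons; case: (b i) => //=.
  by rewrite [_ * \prod_(_ <- _ | _) _]mulrC mulrA => /Aint_poly_div_XsubC.
move=> /polyOverP/(_ 0); rewrite coefZ -horner_coef0 horner_prod.
under eq_bigr do rewrite !hornerE -mulN1r.
rewrite big_split /=; set e := \prod_(i <- s | b i) -1; move=> H1.
have ee : e * e = 1 by rewrite -big_split big1 // => i _; rewrite /= mulrNN mulr1.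
set P := \prod_(i <- s | b i) F i in H1 *.
have -> : c * P = e * (c * (e * P)) by rewrite [RHS]mulrCA [e * (e * P)]mulrA ee mul1r.
by rewrite rpredM //; apply: rpred_prod => i _; rewrite rpredN1.
Qed.

(** * Integrality at a prime *)

(** The p-adic valuation, with value 0 at 0; hence the nonvanishing hypotheses below. *)
Definition pval (p : nat) (r : rat) : int :=
  (logn p `|numq r|)%:Z - (logn p `|denq r|)%:Z.

Lemma pvalM (p : nat) (r s : rat) :
  r != 0 -> s != 0 -> pval p (r * s) = pval p r + pval p s.
Proof.
move=> nzr nzs; have nzrs : r * s != 0 by rewrite mulf_neq0.
have E : numq (r * s) * (denq r * denq s) = numq r * numq s * denq (r * s).
  apply/eqP; rewrite -(inj_eq (intr_inj : injective (intr : int -> rat))).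
  rewrite !intrM !numqE; apply/eqP; ring.
have posn (t : rat) : t != 0 -> (0 < `|numq t|)%N by rewrite absz_gt0 numq_eq0.
have posd (t : rat) : (0 < `|denq t|)%N by rewrite absz_gt0 denq_eq0.
have := congr1 (fun x => logn p `|x|) E; rewrite /pval !abszM !lognM ?muln_gt0 ?posn ?posd //.
lia.
Qed.

Lemma pval_int (p : nat) (n : int) : pval p n%:~R = (logn p `|n|)%:Z.
Proof. by rewrite /pval numq_int denq_int logn1 subr0. Qed.

Lemma pval_nat (p n : nat) : pval p n%:R = (logn p n)%:Z.
Proof. by rewrite -[n%:R]/((n%:Z)%:~R) pval_int. Qed.

Lemma pval1 (p : nat) : pval p 1 = 0.
Proof. by rewrite -[1]/(1%:R) pval_nat logn1. Qed.

Lemma pvalX (p : nat) (r : rat) (n : nat) :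
  r != 0 -> pval p (r ^+ n) = pval p r * n%:Z.
Proof.
move=> nzr; elim: n => [|n IHn].
  by rewrite expr0 mulr0 pval1.
by rewrite exprS pvalM ?expf_neq0 // IHn intS mulrDr mulr1.
Qed.

Lemma pvalV (p : nat) (r : rat) : r != 0 -> pval p r^-1 = - pval p r.
Proof.
move=> nzr; apply/eqP; rewrite -subr_eq0 opprK -pvalM ?invr_eq0 //.
by rewrite mulVf //; apply/eqP/pval1.
Qed.

(** The localization at [p] of the ring of algebraic integers, that is, integrality at all places
    above [p] at once; no place has to be chosen. *)
Definition pint (p : nat) (x : algC) : Prop :=
  exists2 s : nat, ~~ (p %| s)%N & s%:R * x \in Aint.

Section PIntegral.
Variables (p : nat) (pr_p : prime p).

Lemma pint_Aint (x : algC) : x \in Aint -> pint p x.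
Proof. by exists 1%N; rewrite ?mul1r // gtnNdvd // prime_gt1. Qed.

Lemma pintM (x y : algC) : pint p x -> pint p y -> pint p (x * y).
Proof.
move=> [s ps sx] [t pt ty]; exists (s * t)%N.
  by rewrite Euclid_dvdM // negb_or ps.
by rewrite natrM mulrACA rpredM.
Qed.

Lemma pintD (x y : algC) : pint p x -> pint p y -> pint p (x + y).
Proof.
move=> [s ps sx] [t pt ty]; exists (s * t)%N.
  by rewrite Euclid_dvdM // negb_or ps.
rewrite natrM mulrDr rpredD //.
  by rewrite [s%:R * _]mulrC -mulrA rpredM // Aint_Cnat // natr_nat.
by rewrite -mulrA rpredM // Aint_Cnat // natr_nat.
Qed.

Lemma pint_sum (I : Type) (r : seq I) (b : pred I) (F : I -> algC) :
  (forall i, b i -> pint p (F i)) -> pint p (\sum_(i <- r | b i) F i).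
Proof.
move=> H; elim/big_ind: _ => //; last exact: pintD.
by apply: pint_Aint; rewrite rpred0.
Qed.

Lemma pint_prod (I : Type) (r : seq I) (b : pred I) (F : I -> algC) :
  (forall i, b i -> pint p (F i)) -> pint p (\prod_(i <- r | b i) F i).
Proof.
move=> H; elim/big_ind: _ => //; last exact: pintM.
by apply: pint_Aint; rewrite rpred1.
Qed.

Lemma pintX (x : algC) (k : nat) : pint p x -> pint p (x ^+ k).
Proof.
move=> px; elim: k => [|k IHk]; first by apply: pint_Aint; rewrite rpred1.
by rewrite exprS; apply: pintM.
Qed.

Lemma pint_root (x : algC) (k : nat) : (0 < k)%N -> pint p (x ^+ k) -> pint p x.
Proof.
case: k => // k _ [s ps sx]; exists s => //; apply: (@Aint_exp_root k.+1) => //.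
rewrite exprMn exprSr -mulrA rpredM // rpredX // Aint_Cnat //; exact: natr_nat.
Qed.

Lemma pint_nat_cancel (n : nat) (x : algC) :
  ~~ (p %| n)%N -> pint p (n%:R * x) -> pint p x.
Proof.
move=> pn [s ps sx]; exists (s * n)%N; first by rewrite Euclid_dvdM // negb_or ps.
by rewrite natrM -mulrA.
Qed.

Lemma pint_ratP (r : rat) : r != 0 -> pint p (ratr r) <-> 0 <= pval p r.
Proof.
move=> nzr; split=> [[s ps As]|vr].
  have nzs : (s%:R : rat) != 0 by rewrite pnatr_eq0; apply: contraNneq ps => ->; rewrite dvdn0.
  have : ratr (s%:R * r) \in (Num.int : {pred algC}).
    by apply: Cint_rat_Aint; rewrite ?Crat_rat // rmorphM /= ratr_nat.
  rewrite Cint_rat => /intrP[n Dn].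
  have := pvalM p nzs nzr; rewrite Dn pval_int pval_nat.
  by rewrite (_ : logn p s = 0%N) ?add0r => [<- //|]; apply/eqP; rewrite lognE (negPf ps) !andbF.
exists `|denq r|%N; last first.
  apply: Aint_Cint.
  rewrite natr_absz ger0_norm ?denq_ge0 // -(ratr_int _ (denq r)) -rmorphM /= mulrC -numqE ratr_int.
  exact: rpred_int.
apply/negP => pd; have := coprime_num_den r.
have d0 : (0 < logn p `|denq r|)%N by rewrite logn_gt0 mem_primes pr_p absz_gt0 denq_eq0 pd.
have n0 : (0 < logn p `|numq r|)%N by move: vr d0; rewrite /pval; lia.
have pn : (p %| `|numq r|)%N by move: n0; rewrite logn_gt0 mem_primes => /and3P[].
move=> /(coprime_dvdl pn) /(coprime_dvdr pd).
by rewrite /coprime gcdnn => /eqP p1; move: pr_p; rewrite p1.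
Qed.

(* The valuation of [b z^k] is a non-negative element of [(1/l)Z] outside [Z]. *)
Lemma pint_div_root (l d k : nat) (u : int) (r b : rat) (z t : algC) :
  prime l -> (0 < d)%N -> ~~ (l %| k)%N -> ~~ (l %| `|u|)%N ->
  r != 0 -> pval p r = d%:Z * u -> z ^+ (d * l) = ratr r -> t ^+ l = p%:R ->
  pint p (ratr b * z ^+ k) -> pint p (ratr b * z ^+ k / t).
Proof.
move=> pr_l d0 lk lu nzr vr zr tp pbz.
have [->|nzb] := eqVneq b 0.
  by rewrite rmorph0 !mul0r; apply: pint_Aint; rewrite rpred0.
have l0 := prime_gt0 pr_l.
have D0 : (0 < d * l)%N by rewrite muln_gt0 d0.
have nzp : (p%:R : rat) != 0 by rewrite pnatr_eq0 -lt0n prime_gt0.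
(* The rational number (b z^k)^(d l) has valuation d (l v(b) + k u). The bracket is non-negative,
   and nonzero because [l] does not divide k u; being at least 1, it pays for the division by t^(d
   l) = p^d. *)
pose c := b ^+ (d * l) * r ^+ k.
have nzc : c != 0 by rewrite mulf_neq0 ?expf_neq0.
have Dc : (ratr b * z ^+ k) ^+ (d * l) = ratr c.
  by rewrite /c exprMn -exprM [(k * _)%N]mulnC [z ^+ (_ * k)]exprM zr rmorphM !rmorphXn.
have vc : pval p c = d%:Z * (l%:Z * pval p b + k%:Z * u).
  by rewrite /c pvalM ?expf_neq0 // !pvalX // vr PoszM; ring.
have := pintX (d * l) pbz; rewrite Dc pint_ratP // vc pmulr_rge0 ?ltz_nat // => H0.
have H1 : 1 <= l%:Z * pval p b + k%:Z * u.
  have : l%:Z * pval p b + k%:Z * u != 0.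
    apply: contraNneq lk => /eqP; rewrite addr_eq0 => /eqP E.
    have := congr1 absz E; rewrite abszN !abszM /= => E1.
    have : (l %| k * `|u|)%N by rewrite -E1 dvdn_mulr.
    by rewrite Euclid_dvdM // (negPf lu) orbF.
  by move: H0; lia.
apply: (pint_root D0).
rewrite exprMn Dc exprVn mulnC exprM tp.
have -> : ratr c / p%:R ^+ d = ratr (c / p%:R ^+ d) :> algC.
  by rewrite fmorph_div /= rmorphXn /= ratr_nat.
apply/pint_ratP; first by rewrite mulf_neq0 ?invr_eq0 ?expf_neq0.
rewrite pvalM ?invr_eq0 ?expf_neq0 // pvalV ?expf_neq0 // pvalX // pval_nat logn_prime // eqxx mul1r vc.
by rewrite -{2}[d%:Z]mulr1 -mulrBr mulr_ge0 // subr_ge0.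
Qed.

End PIntegral.

(** * Rational functions of an algebraic number *)

Definition evalQ (P : {poly rat}) (z : algC) : algC := (map_poly ratr P).[z].

Lemma evalQD (P Q : {poly rat}) z : evalQ (P + Q) z = evalQ P z + evalQ Q z.
Proof. by rewrite /evalQ rmorphD hornerD. Qed.

Lemma evalQB (P Q : {poly rat}) z : evalQ (P - Q) z = evalQ P z - evalQ Q z.
Proof. by rewrite /evalQ rmorphB hornerD hornerN. Qed.

Lemma evalQM (P Q : {poly rat}) z : evalQ (P * Q) z = evalQ P z * evalQ Q z.
Proof. by rewrite /evalQ rmorphM hornerM. Qed.

Lemma evalQC (c : rat) z : evalQ c%:P z = ratr c.
Proof. by rewrite /evalQ map_polyC hornerC. Qed.

Lemma evalQ1 z : evalQ 1 z = 1.
Proof. by rewrite /evalQ rmorph1 hornerC. Qed.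

Lemma evalQX z : evalQ 'X z = z.
Proof. by rewrite /evalQ map_polyX hornerX. Qed.

Lemma evalQXn (n : nat) z : evalQ 'X^n z = z ^+ n.
Proof. by rewrite /evalQ map_polyXn hornerXn. Qed.

Lemma evalQ_comp (P Q : {poly rat}) z : evalQ (P \Po Q) z = evalQ P (evalQ Q z).
Proof. by rewrite /evalQ map_comp_poly horner_comp. Qed.

Lemma evalQ_sum (I : Type) (s : seq I) (F : I -> {poly rat}) z :
  evalQ (\sum_(i <- s) F i) z = \sum_(i <- s) evalQ (F i) z.
Proof. by rewrite /evalQ rmorph_sum horner_sum. Qed.

Lemma evalQ_exp (P : {poly rat}) (n : nat) z : evalQ (P ^+ n) z = evalQ P z ^+ n.
Proof. by rewrite /evalQ rmorphXn horner_exp. Qed.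

Lemma aut_evalQ (nu : {rmorphism algC -> algC}) (P : {poly rat}) z :
  nu (evalQ P z) = evalQ P (nu z).
Proof.
rewrite /evalQ -horner_map -map_poly_comp; congr (_.[_]).
by apply: eq_map_poly => c /=; rewrite fmorph_rat.
Qed.

Lemma minCpoly_conj (x z : algC) : root (minCpoly x) z -> minCpoly z = minCpoly x.
Proof.
have [p [Dp mp] dvp] := minCpolyP x; have [q [Dq mq] dvq] := minCpolyP z.
have [lt1p irr_p] := minCpoly_irreducible Dp.
rewrite Dp dvq => dvqp; rewrite Dq; congr map_poly.
apply/eqP; rewrite -eqp_monic //; apply: irr_p => //.
by rewrite -(size_map_poly (ratr : {rmorphism rat -> algC})) -Dq neq_ltn size_minCpoly orbT.
Qed.

(** Every root of [F] is conjugate to [x], so the minimal polynomial of [x] can be divided out of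
    [F] until a constant is left. *)
Lemma monic_conj_roots_exp (x : algC) (F : {poly rat}) :
  F \is monic -> (forall z, root (map_poly ratr F) z -> root (minCpoly x) z) ->
  exists N : nat, map_poly ratr F = minCpoly x ^+ N.
Proof.
have [p [Dp mp] dvp] := minCpolyP x.
have [n] := ubnP (size F); elim: n F => // n IHn F; rewrite ltnS => szF mF rtF.
have [szF1|szF1] := eqVneq (size F) 1%N.
  exists 0%N; rewrite expr0; have /eqP/size_poly1P[c nzc Dc] := szF1.
  by move: mF; rewrite Dc monicE lead_coefC => /eqP->; rewrite rmorph1.
have [z Fz] : exists z : algC, root (map_poly ratr F) z.
  by apply/closed_rootP; rewrite size_map_poly.
have pF : p %| F.
  have [q [Dq mq] dvq] := minCpolyP z.
  have <- : q = p.
    by apply: (map_poly_inj (ratr : {rmorphism rat -> algC})); rewrite -Dq -Dp; apply: minCpoly_conj; apply: rtF.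
  by rewrite -dvq.
have DF : F = (F %/ p) * p by rewrite divpK.
have mFp : F %/ p \is monic by move: mF; rewrite {1}DF monicMr.
case: (IHn (F %/ p)) => //.
- apply: leq_trans szF; rewrite size_divp ?monic_neq0 //.
  have lt1p : (1 < size p)%N.
    by rewrite -(size_map_poly (ratr : {rmorphism rat -> algC})) -Dp size_minCpoly.
  by rewrite ltn_subrL -ltnS prednK ?(ltnW lt1p) // lt1p size_poly_gt0 monic_neq0.
- by move=> t Ft; apply: rtF; rewrite DF rmorphM rootM Ft.
move=> N DN; exists N.+1; rewrite DF rmorphM /= DN exprSr -Dp //.
Qed.

Lemma exists_rootsC (n : nat) (c : algC) : (0 < n)%N -> c != 0 ->
  exists s : seq algC, [/\ uniq s, size s = n & forall z, (z \in s) = (z ^+ n == c)].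
Proof.
move=> n0 nzc; have [w prw] := C_prim_root_exists n0.
pose y := n.-root c; have yn : y ^+ n = c by rewrite /y rootCK.
have nzy : y != 0 by apply: contraNneq nzc => y0; rewrite -yn y0 expr0n gtn_eqF.
exists [seq w ^+ i * y | i <- iota 0 n]; split.
- rewrite map_inj_in_uniq ?iota_uniq // => i j; rewrite !mem_iota /= !add0n => lti ltj.
  move=> /(mulIf nzy)/eqP; rewrite (eq_prim_root_expr prw) !modn_small // => /eqP //.
- by rewrite size_map size_iota.
move=> z; apply/mapP/eqP => [[i _ ->]|zn].
  by rewrite exprMn exprAC (prim_expr_order prw) expr1n mul1r.
have [|i Di] := prim_rootP prw (x := z / y).
  by rewrite exprMn exprVn zn yn divff.
by exists (nat_of_ord i); rewrite ?mem_iota ?ltn_ord // -Di divfK.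
Qed.

Definition Qadjoin (y : algC) : set algC := [set a | exists P, a = evalQ P y].

Lemma Qadjoin_inv (y a : algC) : Qadjoin y a -> Qadjoin y a^-1.
Proof.
move=> [P ->]; have [p [Dp mp] dvp] := minCpolyP y.
have [->|nz] := eqVneq (evalQ P y) 0; first by exists 0; rewrite invr0 /evalQ rmorph0 horner0.
have : coprimep p P.
  rewrite irreducible_poly_coprime; first by rewrite -dvp rootE.
  exact: minCpoly_irreducible Dp.
move=> /Bezout_eq1_coprimepP[[u v] /= E]; exists v.
apply: (mulIf nz); rewrite mulVf //.
have py : evalQ p y = 0 by apply/eqP; rewrite -rootE dvp.
have := congr1 (fun Q => evalQ Q y) E; rewrite /= evalQD !evalQM py mulr0 add0r => ->.
by rewrite evalQ1.
Qed.

Lemma Qadjoin_subfield (y : algC) : subfield (Qadjoin y).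
Proof.
split; first by rewrite inE; exists 1; rewrite evalQ1.
- by move=> a b; rewrite !inE => -[P ->] [Q ->]; exists (P - Q); rewrite evalQB.
- move=> a b; rewrite !inE => -[P ->] /Qadjoin_inv[Q ->].
  by exists (P * Q); rewrite evalQM.
Qed.

Section SubfieldClosure.
Variables (L : set algC) (fL : subfield L).

Lemma subfield1 : L 1. Proof. by case: fL => + _ _; rewrite inE. Qed.

Lemma subfieldB a b : L a -> L b -> L (a - b).
Proof. by case: fL => _ + _ => /(_ a b); rewrite !inE; apply. Qed.

Lemma subfield_div a b : L a -> L b -> L (a / b).
Proof. by case: fL => _ _ /(_ a b); rewrite !inE; apply. Qed.

Lemma subfield0 : L 0. Proof. by rewrite -(subrr 1); apply: subfieldB; apply: subfield1. Qed.

Lemma subfieldN a : L a -> L (- a).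
Proof. by move=> La; rewrite -[- a]add0r; apply: subfieldB => //; apply: subfield0. Qed.

Lemma subfieldD a b : L a -> L b -> L (a + b).
Proof. by move=> La Lb; rewrite -[b]opprK; apply: subfieldB => //; apply: subfieldN. Qed.

Lemma subfieldM a b : L a -> L b -> L (a * b).
Proof.
move=> La Lb; rewrite -[b]invrK; apply: subfield_div => //.
by rewrite -[b^-1]mul1r; apply: subfield_div => //; apply: subfield1.
Qed.

Lemma subfieldX a n : L a -> L (a ^+ n).
Proof.
by move=> La; elim: n => [|n IHn]; [apply: subfield1 | rewrite exprS; apply: subfieldM].
Qed.

Lemma subfield_rat (r : rat) : L (ratr r).
Proof.
have Ln (n : nat) : L n%:R.
  by elim: n => [|n IHn]; [apply: subfield0 | rewrite -addn1 natrD; apply: subfieldD => //; apply: subfield1].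
have Li (n : int) : L n%:~R.
  by case: n => n; [apply: Ln | rewrite NegzE rmorphN /=; apply: subfieldN; apply: Ln].
by apply: subfield_div.
Qed.

Lemma subfield_evalQ (P : {poly rat}) y : L y -> L (evalQ P y).
Proof.
move=> Ly; elim/poly_ind: P => [|P c IHP].
  by rewrite /evalQ rmorph0 horner0; apply: subfield0.
rewrite evalQD evalQM evalQX evalQC; apply: subfieldD; last exact: subfield_rat.
exact: subfieldM.
Qed.

End SubfieldClosure.

(** * Conjugates in a radical extension *)

Lemma polyOver_Crat (p : {poly algC}) :
  p \is a polyOver Crat -> exists q : {poly rat}, p = map_poly ratr q.
Proof.
move=> /polyOverP Qp; exists (\poly_(i < size p) getCrat p`_i).
apply/polyP => i; rewrite coef_map coef_poly; case: ifP => [_|/negbT].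
  by rewrite /= getCratK.
by rewrite -leqNgt => szi; rewrite /= rmorph0 nth_default.
Qed.

Lemma perm_map_stable (T : eqType) (f : T -> T) (s : seq T) :
  injective f -> uniq s -> {in s, forall z, f z \in s} -> perm_eq (map f s) s.
Proof.
move=> injf us fs; have uf : uniq (map f s) by rewrite map_inj_uniq.
have [] := uniq_min_size (s1 := map f s) (s2 := s) => //.
- by move=> _ /mapP[z zs ->]; apply: fs.
- by rewrite size_map.
by move=> _ eqi; apply: uniq_perm.
Qed.

Lemma perm_rootsC_mul (n : nat) (c w : algC) (s : seq algC) :
  uniq s -> (forall z, (z \in s) = (z ^+ n == c)) -> w ^+ n = 1 -> w != 0 ->
  perm_eq [seq w * z | z <- s] s.
Proof.
move=> us ms wn nzw; apply: perm_map_stable => //; first exact: mulfI.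
by move=> z; rewrite !ms exprMn wn mul1r.
Qed.

Lemma perm_rootsC_aut (n : nat) (c : rat) (s : seq algC) (nu : {rmorphism algC -> algC}) :
  uniq s -> (forall z, (z \in s) = (z ^+ n == ratr c)) -> perm_eq (map nu s) s.
Proof.
move=> us ms; apply: perm_map_stable => //; first exact: fmorph_inj.
by move=> z; rewrite !ms -rmorphXn /= => /eqP->; rewrite fmorph_rat.
Qed.

Lemma minCpoly_radical (D : nat) (r : rat) (y : algC) :
  (0 < D)%N -> y ^+ D = ratr r -> deg y = D -> minCpoly y = 'X^D - (ratr r)%:P.
Proof.
move=> D0 yD degy; have [p [Dp mp] dvp] := minCpolyP y.
have mq : 'X^D - r%:P \is monic by apply: monicXnsubC.
have E : map_poly ratr ('X^D - r%:P) = 'X^D - (ratr r)%:P :> {poly algC}.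
  by rewrite rmorphB /= map_polyXn map_polyC.
have pq : p %| 'X^D - r%:P by rewrite -dvp E rootE !hornerE yD subrr.
have szp : size p = D.+1.
  rewrite -(size_map_poly (ratr : {rmorphism rat -> algC})) -Dp -degy /deg prednK //.
  exact: ltnW (size_minCpoly y).
have : p %= 'X^D - r%:P by rewrite -(dvdp_size_eqp pq) szp size_XnsubC.
by rewrite eqp_monic // => /eqP Dpq; rewrite Dp Dpq E.
Qed.

(** Transports algebraic relations from [y] to every root of X^D = r, in place of the embedding that
    sends [y] to [z]. *)
Lemma evalQ_conj0 (D : nat) (r : rat) (y z : algC) (Q : {poly rat}) :
  (0 < D)%N -> y ^+ D = ratr r -> deg y = D -> z ^+ D = ratr r ->
  evalQ Q y = 0 -> evalQ Q z = 0.
Proof.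
move=> D0 yD degy zD Qy; have [p [Dp mp] dvp] := minCpolyP y.
have : p %| Q by rewrite -dvp rootE -/(evalQ Q y) Qy.
move=> /dvdpP[q ->]; rewrite evalQM [evalQ p z](_ : _ = 0) ?mulr0 //.
by rewrite /evalQ -Dp (minCpoly_radical D0 yD degy) !hornerE zD subrr.
Qed.

Section RadicalConjugates.
Variables (D : nat) (r : rat) (y : algC) (s : seq algC).
Hypotheses (D0 : (0 < D)%N) (yD : y ^+ D = ratr r) (degy : deg y = D).
Hypotheses (us : uniq s) (szs : size s = D) (ms : forall z, (z \in s) = (z ^+ D == ratr r)).

Lemma root_minCpoly_conj (P : {poly rat}) (z : algC) :
  z ^+ D = ratr r -> root (minCpoly (evalQ P y)) (evalQ P z).
Proof.
move=> zD; have [p [Dp mp] dvp] := minCpolyP (evalQ P y).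
have E t : (map_poly ratr p).[evalQ P t] = evalQ (p \Po P) t by rewrite evalQ_comp.
rewrite Dp rootE E; apply/eqP; apply: (evalQ_conj0 D0 yD degy zD).
by rewrite -E; apply/eqP; rewrite -rootE -Dp root_minCpoly.
Qed.

(** The product is the characteristic polynomial of [evalQ P y] in the field generated by [y]:
    automorphisms permute [s], so it is rational, and all its roots are conjugates of
    [evalQ P y]. *)
Lemma prod_conj_exp (P : {poly rat}) : exists2 N : nat,
  \prod_(z <- s) ('X - (evalQ P z)%:P) = minCpoly (evalQ P y) ^+ N
  & (N * deg (evalQ P y))%N = D.
Proof.
set F := \prod_(z <- s) _.
have [f Df] : exists q : {poly rat}, F = map_poly ratr q.
  apply: polyOver_Crat; apply/polyOverP => i; apply: Crat_aut_fixed => nu.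
  rewrite -coef_map /F rmorph_prod /=.
  under eq_bigr do rewrite map_polyXsubC aut_evalQ.
  rewrite -(big_map nu predT (fun z => 'X - (evalQ P z)%:P)).
  by rewrite (perm_big _ (perm_rootsC_aut nu us ms)).
have mf : f \is monic.
  by rewrite -(map_monic (ratr : {rmorphism rat -> algC})) /= -Df monic_prod_XsubC.
have [|N DN] := monic_conj_roots_exp (x := evalQ P y) mf.
  move=> t; rewrite -Df /F -(big_map (evalQ P) predT (fun z => 'X - z%:P)).
  rewrite root_prod_XsubC => /mapP[z zs ->].
  by apply: root_minCpoly_conj; apply/eqP; rewrite -ms.
exists N; first by rewrite Df DN.
have : size F = D.+1.
  by rewrite /F -(big_map (evalQ P) predT (fun z => 'X - z%:P)) size_prod_XsubC size_map szs.
by move=> /(congr1 predn); rewrite Df DN size_exp /deg mulnC.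
Qed.

End RadicalConjugates.

(** For [s] the D-th roots of r and [W] the nontrivial l-th roots of unity, this is up to sign the
    norm to the rationals of the discriminant of P(y) over the field of y^l, over which the
    conjugates of y are the w y. *)
Definition reldisc (P : {poly rat}) (s W : seq algC) : algC :=
  \prod_(z <- s) \prod_(w <- W) (evalQ P z - evalQ P (w * z)).

Lemma reldisc_Crat (P : {poly rat}) (s W : seq algC) :
  (forall nu : {rmorphism algC -> algC}, perm_eq (map nu s) s) ->
  (forall nu : {rmorphism algC -> algC}, perm_eq (map nu W) W) ->
  reldisc P s W \in Crat.
Proof.
move=> nus nuW; apply: Crat_aut_fixed => nu; rewrite /reldisc rmorph_prod /=.
rewrite -[RHS](perm_big _ (nus nu)) big_map; apply: eq_bigr => z _ /=.
rewrite rmorph_prod -[RHS](perm_big _ (nuW nu)) big_map; apply: eq_bigr => w _ /=.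
by rewrite rmorphB !aut_evalQ rmorphM.
Qed.

(** Expanding the product gives one term for each subset J: the product of F over J and of -G
    outside J. One factor c clears the denominators of each of the two parts. *)
Lemma Aint_prod_sub (I : Type) (s : seq I) (c : algC) (F G : I -> algC) :
  c *: \prod_(z <- s) ('X - (F z)%:P) \is a polyOver Aint ->
  c *: \prod_(z <- s) ('X - (G z)%:P) \is a polyOver Aint ->
  c ^+ 2 * \prod_(z <- s) (F z - G z) \in Aint.
Proof.
case: s => [|z0 s0]; first by rewrite !big_nil mulr1 !alg_polyC !polyOverC => Ac _; rewrite rpredX.
set s := z0 :: s0 => AF AG; rewrite (big_nth z0) big_mkord.
rewrite (bigA_distr 1 +%R) mulr_sumr rpred_sum // => J _.
rewrite (bigID (fun i => i \in J)) /= expr2 mulrACA rpredM //.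
  under eq_bigr => i iJ do rewrite iJ.
  by apply: (@Aint_lead_prod_roots _ _ _ (mem J)); rewrite (big_nth z0) big_mkord in AF.
under eq_bigr => i iJ do rewrite (negPf iJ) -mulN1r.
rewrite big_split /= mulrCA rpredM //; first by apply: rpred_prod => i _; apply: rpredN1.
by apply: (@Aint_lead_prod_roots _ _ _ (predC (mem J))); rewrite (big_nth z0) big_mkord in AG.
Qed.

(** For fixed w the families P(z) and P(w z) are the roots of the same polynomial, since z -> w z
    permutes [s]; each w therefore costs c^2. *)
Lemma reldisc_Aint (P : {poly rat}) (c : algC) (s W : seq algC) :
  (forall w, w \in W -> perm_eq [seq w * z | z <- s] s) ->
  c *: \prod_(z <- s) ('X - (evalQ P z)%:P) \is a polyOver Aint ->
  c ^+ (2 * size W) * reldisc P s W \in Aint.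
Proof.
move=> Ws As; rewrite /reldisc exchange_big /= exprM.
have -> : (c ^+ 2) ^+ size W = \prod_(w <- W) c ^+ 2.
  by rewrite big_const_seq count_predT iter_mulr_1.
rewrite -big_split /= big_seq_cond; apply: rpred_prod => w; rewrite andbT => wW.
apply: (@Aint_prod_sub _ _ _ (evalQ P) (fun z => evalQ P (w * z))) => //.
by rewrite -(big_map _ predT (fun z => 'X - (evalQ P z)%:P)) (perm_big _ (Ws w wW)).
Qed.

(** * Divisibility of the relative discriminant *)

Lemma intr_Fp_eq0 (p : nat) (z : int) : prime p ->
  (z%:~R == 0 :> 'F_p) = (p %| `|z|)%N.
Proof.
move=> pr_p; have chp := pchar_Fp pr_p.
case: z => n; first by rewrite -(dvdn_pcharf chp).
by rewrite NegzE rmorphN oppr_eq0 /= -(dvdn_pcharf chp).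
Qed.

(** A primitive polynomial is nonzero modulo [p]; its degree being less than [p], it cannot vanish
    at all [p] residues. *)
Lemma exists_nonroot_mod (p : nat) (f : {poly int}) :
  prime p -> zcontents f = 1 -> (size f <= p)%N ->
  exists m : nat, ~~ (p %| `|f.[m%:Z]|)%N.
Proof.
move=> pr_p cf szf; apply/not_existsP => H.
have {}H (m : nat) : (p %| `|f.[m%:Z]|)%N by apply/negPn/negP; apply: H.
pose g : {poly 'F_p} := map_poly intr f.
have g0 : g = 0.
  apply/eqP/negPn/negP => nzg.
  have := max_poly_roots nzg (rs := enum 'F_p); rewrite enum_uniq -cardE card_Fp //.
  have -> : all (root g) (enum 'F_p).
    apply/allP => x _; rewrite rootE; have <- : ((nat_of_ord x)%:Z)%:~R = x :> 'F_p by rewrite -[RHS]natr_Zp.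
    by rewrite /g horner_map /= intr_Fp_eq0.
  move=> /(_ isT isT); rewrite ltnNge; apply/negP; rewrite negbK.
  exact: leq_trans (size_poly _ _) szf.
have : (p%:Z %| zcontents f)%Z.
  rewrite dvdz_contents; apply/polyOverP => i.
  have : g`_i = 0 by rewrite g0 coef0.
  by rewrite coef_map /= => /eqP; rewrite intr_Fp_eq0.
by rewrite cf dvdzE /= dvdn1 => /eqP p1; move: pr_p; rewrite p1.
Qed.

(** Fourier inversion over the D-th roots of unity. When D is prime to p, it makes each single term
    of Q integral at p as soon as all conjugate values of Q are. *)
Lemma evalQ_coef_sum (D k : nat) (Q : {poly rat}) (x z : algC) :
  (size Q <= D)%N -> (k < D)%N -> D.-primitive_root x ->
  D%:R * (ratr Q`_k * z ^+ k) = \sum_(t < D) x ^- (t * k) * evalQ Q (x ^+ t * z).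
Proof.
move=> szQ ltkD prx; have D0 : (0 < D)%N by apply: leq_ltn_trans ltkD.
have nzx : x != 0.
  apply/eqP => x0; have := prim_expr_order prx; rewrite x0 expr0n gtn_eqF // => /eqP.
  by rewrite eq_sym oner_eq0.
have szmQ : (size (map_poly ratr Q : {poly algC}) <= D)%N by rewrite size_map_poly.
transitivity (\sum_(t < D) \sum_(i < D) ratr Q`_i * z ^+ i * (x ^+ i / x ^+ k) ^+ t).
  rewrite exchange_big /= (bigD1 (Ordinal ltkD)) //= divff ?expf_neq0 //.
  under [X in _ = X + _]eq_bigr do rewrite expr1n mulr1.
  rewrite sumr_const card_ord mulr_natl big1 ?addr0 // => i neik.
  rewrite -mulr_sumr; apply/eqP; rewrite mulf_eq0; apply/orP; right.
  set q := _ / _; have nq1 : q - 1 != 0.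
    rewrite subr_eq0 /q; apply: contraNneq neik => /divr1_eq/eqP.
    by rewrite (eq_prim_root_expr prx) !modn_small //.
  apply/eqP; apply: (mulfI nq1); rewrite -subrX1 mulr0.
  rewrite /q exprMn exprVn -!exprM ![(_ * D)%N]mulnC !exprM (prim_expr_order prx) !expr1n.
  by rewrite invr1 mulr1 subrr.
apply: eq_bigr => t _; rewrite /evalQ (horner_coef_wide _ szmQ) mulr_sumr.
apply: eq_bigr => i _; rewrite coef_map /= !exprMn exprVn -!exprM [(k * t)%N]mulnC [(i * t)%N]mulnC.
by ring.
Qed.

Section PadicDivisibility.
Variables (p l d : nat) (r : rat) (y : algC) (s W : seq algC) (u : int).
Local Notation D := (d * l)%N.
Hypotheses (pr_p : prime p) (pr_l : prime l) (d0 : (0 < d)%N).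
Hypotheses (nzr : r != 0) (yD : y ^+ D = ratr r) (degy : deg y = D).
Hypotheses (us : uniq s) (szs : size s = D).
Hypothesis ms : forall z, (z \in s) = (z ^+ D == ratr r).
Hypothesis mW : forall w, w \in W -> w ^+ l = 1.
Hypotheses (ltDp : (D < p)%N) (vr : pval p r = d%:Z * u) (lu : ~~ (l %| `|u|)%N).

Let D0 : (0 < D)%N. Proof. by rewrite muln_gt0 d0 prime_gt0. Qed.

(** Here [t] is p^(1/l). In Q(z) - Q(w z) the terms with l | k cancel; every other term b z^k is
    integral at [p] by Fourier inversion, hence divisible by [t] by [pint_div_root]. *)
Lemma pint_conj_sub (Q : {poly rat}) (z w t : algC) :
  (size Q <= D)%N -> (forall x, x \in s -> pint p (evalQ Q x)) ->
  z \in s -> w ^+ l = 1 -> t ^+ l = p%:R -> pint p ((evalQ Q z - evalQ Q (w * z)) / t).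
Proof.
move=> szQ pQ zs wl tl.
have szmQ : (size (map_poly ratr Q : {poly algC}) <= D)%N by rewrite size_map_poly.
have Aw : w \in Aint by apply: (@Aint_exp_root l); rewrite ?prime_gt0 // wl rpred1.
rewrite /evalQ !(horner_coef_wide _ szmQ) -sumrB mulr_suml; apply: pint_sum => // k _.
rewrite !coef_map /= exprMn.
have -> : (ratr Q`_k * z ^+ k - ratr Q`_k * (w ^+ k * z ^+ k)) / t
          = (1 - w ^+ k) * (ratr Q`_k * z ^+ k / t) by ring.
have [lk|lk] := boolP (l %| k)%N.
  move: lk => /dvdnP[j ->]; rewrite mulnC exprM wl expr1n subrr mul0r.
  by apply: pint_Aint; rewrite ?rpred0.
apply: pintM => //; first by apply: pint_Aint; rewrite ?rpredB ?rpred1 ?rpredX.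
have zD : z ^+ D = ratr r by apply/eqP; rewrite -ms.
apply: (pint_div_root pr_p pr_l d0 lk lu nzr vr zD tl).
have [x prx] := C_prim_root_exists D0.
apply: (@pint_nat_cancel _ pr_p D); first by rewrite gtnNdvd.
rewrite (evalQ_coef_sum _ szQ _ prx) //; apply: pint_sum => // i _; apply: pintM => //.
  rewrite -exprVn; apply: pint_Aint => //; rewrite rpredX //.
  apply: (@Aint_exp_root D) => //; rewrite exprVn (prim_expr_order prx) invr1; exact: rpred1.
apply: pQ; rewrite ms exprMn -exprM mulnC exprM (prim_expr_order prx) expr1n mul1r zD.
exact: eqxx.
Qed.

(* The substitution [1 / (m - X)] with [f(m)] prime to [p] makes all conjugates [p]-integral
   without changing the discriminant of the binary form attached to [f]. *)
Lemma pint_reldisc (P : {poly rat}) (f : {poly int}) (N : nat) :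
  is_int_minpoly (evalQ P y) f -> (N * deg (evalQ P y))%N = D ->
  \prod_(z <- s) ('X - (evalQ P z)%:P) = minCpoly (evalQ P y) ^+ N ->
  pint p ((lead_coef f)%:~R ^+ (N * (2 * size W)) * reldisc P s W / p%:R ^+ (d * size W)).
Proof.
move=> [cf Df] ND prodE; set c : algC := (lead_coef f)%:~R in Df *; set a := evalQ P y in Df ND prodE.
have nzc : c != 0.
  by rewrite intr_eq0 lead_coef_eq0 -zcontents_eq0 cf.
have szf : (size f <= p)%N.
  have -> : size f = (deg a).+1.
    rewrite /deg prednK ?(ltnW (size_minCpoly a)) // -(size_scale _ nzc) -Df.
    by rewrite size_map_inj_poly //; apply: intr_inj.
  apply: leq_ltn_trans ltDp; rewrite -ND leq_pmull //.
  by move: D0; rewrite -ND muln_gt0 => /andP[].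
have [m pm] := exists_nonroot_mod pr_p cf szf.
set fm := f.[m%:Z] in pm.
(* In f = q (X - x) the cofactor has integral coefficients, so 1 / (m - x) is b / f(m) with b = q(m)
   integral. *)
have fmE (x : algC) : root (minCpoly a) x -> exists2 b, b \in Aint & b * (m%:R - x) = fm%:~R.
  move=> rx; have : root (map_poly intr f : {poly algC}) x by rewrite Df rootZ.
  move=> /factor_theorem[q Dq]; exists q.[m%:R].
    have Aq : q \is a polyOver Aint.
      apply: (@Aint_poly_div_XsubC _ x); rewrite -Dq; apply/polyOverP => i.
      by rewrite coef_map /= Aint_int.
    by apply: rpred_horner => //; rewrite Aint_Cnat // natr_nat.
  by have := congr1 (fun g : {poly algC} => g.[m%:R]) Dq; rewrite /= !hornerE (horner_map _ f m%:Z) => <-.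
have nzfm : fm%:~R != 0 :> algC.
  by rewrite intr_eq0; apply: contraNneq pm => ->; rewrite dvdn0.
have nzm (x : algC) : root (minCpoly a) x -> m%:R - x != 0.
  by move=> /fmE[b _ E]; apply: contraNneq nzfm => E0; rewrite -E E0 mulr0.
have rtz z : z \in s -> root (minCpoly a) (evalQ P z).
  by rewrite ms => /eqP zD; apply: (root_minCpoly_conj D0 yD degy).
have [Q0 DQ0] : Qadjoin y (m%:R - a)^-1.
  by apply: Qadjoin_inv; exists (m%:R%:P - P); rewrite evalQB evalQC ratr_nat.
have [mu [Dmu mmu] dvmu] := minCpolyP y.
(* Reduction modulo the minimal polynomial of y bounds the size by D, as the Fourier inversion
   requires. *)
pose Q := Q0 %% mu.
have Qy : evalQ Q y = (m%:R - a)^-1.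
  have muy : evalQ mu y = 0 by apply/eqP; rewrite -rootE -Dmu root_minCpoly.
  by rewrite DQ0 [in RHS](divp_eq Q0 mu) evalQD evalQM muy mulr0 add0r.
have szQ : (size Q <= D)%N.
  rewrite -ltnS -[X in (_ < X.+1)%N]degy /deg prednK ?(ltnW (size_minCpoly y)) //.
  by rewrite Dmu size_map_poly ltn_modp monic_neq0.
have Qz z : z \in s -> evalQ Q z = (m%:R - evalQ P z)^-1.
  move=> zs; have nz := nzm _ (rtz z zs).
  have : evalQ (Q * (m%:R%:P - P) - 1) z = 0.
    apply: (evalQ_conj0 D0 yD degy); first by apply/eqP; rewrite -ms.
    rewrite evalQB evalQ1 evalQM evalQB evalQC ratr_nat Qy mulVf ?subrr //.
    exact: nzm (root_minCpoly a).
  rewrite evalQB evalQ1 evalQM evalQB evalQC ratr_nat => /eqP; rewrite subr_eq0 => /eqP E.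
  by apply: (mulIf nz); rewrite E mulVf.
have pQ z : z \in s -> pint p (evalQ Q z).
  move=> zs; exists `|fm|%N => //; have [b Ab E] := fmE _ (rtz z zs).
  rewrite natr_absz Qz //; case: (ger0P fm) => _; rewrite ?rmorphN ?mulNr ?rpredN /=.
    by rewrite -E mulfK // nzm // rtz.
  by rewrite -E mulfK // nzm // rtz.
have wzs z w : z \in s -> w \in W -> w * z \in s.
  by move=> + wW; rewrite !ms => /eqP zD; rewrite exprMn mulnC exprM mW // expr1n mul1r mulnC zD.
have l0 := prime_gt0 pr_l.
pose t : algC := l.-root p%:R; have tl : t ^+ l = p%:R by rewrite rootCK.
(* The factors m - P(z) introduced by the substitution use up the powers of c, leaving powers of the
   integer f(m). *)
have E1 : c ^+ N * \prod_(z <- s) (m%:R - evalQ P z) = fm%:~R ^+ N.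
  have := congr1 (fun g : {poly algC} => g.[m%:R]) prodE.
  rewrite /= horner_prod horner_exp; under eq_bigr do rewrite !hornerE.
  move=> ->; rewrite -exprMn -hornerZ -Df.
  by rewrite (horner_map _ f m%:Z).
have permW w : w \in W -> perm_eq [seq w * z | z <- s] s.
  move=> wW; apply: (perm_rootsC_mul us ms).
    by rewrite mulnC exprM mW // expr1n.
  apply/eqP => w0; have := mW wW; rewrite w0 expr0n gtn_eqF // => /eqP.
  by rewrite eq_sym oner_eq0.
(* From 1 / (m - x) - 1 / (m - x') = (x - x') / ((m - x) (m - x')): as w z runs through [s] together
   with z, every w contributes each m - P(z) twice. *)
have E2 : reldisc P s W = (\prod_(z <- s) (m%:R - evalQ P z)) ^+ (2 * size W) *
     \prod_(z <- s) \prod_(w <- W) (evalQ Q z - evalQ Q (w * z)).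
  set X := \prod_(z <- s) _.
  rewrite /reldisc exprM.
  have -> : (X ^+ 2) ^+ size W = \prod_(w <- W) X ^+ 2.
    by rewrite big_const_seq count_predT iter_mulr_1.
  rewrite [LHS]exchange_big [in RHS]exchange_big -big_split /= !big_seq.
  apply: eq_bigr => w wW.
  have -> : X ^+ 2 = X * \prod_(z <- s) (m%:R - evalQ P (w * z)).
    by rewrite expr2 {2}/X -(perm_big _ (permW w wW)) big_map.
  rewrite -!big_split /= !big_seq; apply: eq_bigr => z zs.
  have nz1 := nzm _ (rtz z zs); have nz2 := nzm _ (rtz _ (wzs z w zs wW)).
  rewrite !Qz ?wzs //; field; exact/andP.
(* One factor t = p^(1/l) for each pair (z, w), and [s] has d l elements. *)
have E3 : p%:R ^+ (d * size W) = \prod_(z <- s) \prod_(w <- W) t.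
  rewrite !big_const_seq !count_predT !iter_mulr_1 szs -tl -!exprM.
  by congr (_ ^+ _); ring.
rewrite E2 exprM mulrA -exprMn E1 E3 -!mulrA -prodf_div.
apply: pintM => //.
  by apply: pintX => //; apply: pintX => //; apply: pint_Aint => //; apply: Aint_int.
rewrite big_seq; apply: pint_prod => // z zs.
rewrite -prodf_div big_seq; apply: pint_prod => // w wW.
by apply: pint_conj_sub => //; apply: mW.
Qed.

End PadicDivisibility.

(** * Upper bound for the relative discriminant *)

Definition max1 (z : algC) : algC := Num.max 1 `|z|.

Lemma max1_ge1 (z : algC) : 1 <= max1 z.
Proof. by rewrite /max1 comparable_le_max ?lexx // real_comparable ?rpred1 ?normr_real. Qed.

Lemma max1_ge_norm (z : algC) : `|z| <= max1 z.
Proof. by rewrite /max1 comparable_le_max ?lexx ?orbT // real_comparable ?rpred1 ?normr_real. Qed.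

Lemma max1_ge0 (z : algC) : 0 <= max1 z.
Proof. exact: le_trans ler01 (max1_ge1 z). Qed.

(** Leibniz in place of Hadamard: the factor n! instead of n^(n/2) only changes the constant in
    front of ln l in the height bound. *)
Lemma vandermonde_norm_le (n : nat) (a : 'I_n -> algC) :
  \prod_(i < n) \prod_(j < n | (i < j)%N) `|a j - a i| <=
  n`!%:R * \prod_(i < n) max1 (a i) ^+ n.-1.
Proof.
pose A : 'rV_n := \row_i a i.
have -> : \prod_(i < n) \prod_(j < n | (i < j)%N) `|a j - a i| = `|\det (Vandermonde n A)|.
  rewrite det_Vandermonde normr_prod; apply: eq_bigr => i _.
  by rewrite normr_prod; apply: eq_bigr => j _; rewrite !mxE.
rewrite /determinant; apply: le_trans (ler_norm_sum _ _ _) _.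
have -> : n`!%:R * \prod_(i < n) max1 (a i) ^+ n.-1 =
    \sum_(e : 'S_n) \prod_(i < n) max1 (a i) ^+ n.-1.
  by rewrite sumr_const card_Sn mulr_natl.
apply: ler_sum => e _; rewrite normrM normrX normrN1 expr1n mul1r normr_prod.
rewrite [leRHS](reindex_inj (@perm_inj _ e)) /=; apply: ler_prod => i _.
rewrite !mxE normr_ge0 /= normrX.
apply: le_trans (_ : max1 (a (e i)) ^+ i <= _).
  by apply: lerXn2r; rewrite ?nnegrE ?max1_ge0 ?normr_ge0 ?max1_ge_norm.
apply: ler_weXn2l; first exact: max1_ge1.
by rewrite -ltnS prednK // (leq_ltn_trans _ (ltn_ord i)).
Qed.

Lemma prod_neq_lt_sqr (R : comPzRingType) (n : nat) (F : 'I_n -> 'I_n -> R) :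
  (forall i j, F i j = F j i) ->
  \prod_(i < n) \prod_(j < n | j != i) F i j =
  (\prod_(i < n) \prod_(j < n | (i < j)%N) F i j) ^+ 2.
Proof.
move=> symF; rewrite expr2.
have -> : \prod_(i < n) \prod_(j < n | j != i) F i j =
   \prod_(i < n) (\prod_(j < n | (i < j)%N) F i j * \prod_(j < n | (j < i)%N) F i j).
  apply: eq_bigr => i _; rewrite (bigID (fun j : 'I_n => (i < j)%N)) /=.
  congr (_ * _); apply: eq_bigl => j; rewrite -(inj_eq val_inj) /=; lia.
rewrite big_split /=; congr (_ * _).
rewrite (exchange_big_dep xpredT) //=; apply: eq_bigr => i _.
by apply: eq_bigr => j _; apply: symF.
Qed.

Section UpperBound.
Variables (l : nat) (s W : seq algC) (P : {poly rat}).
Hypotheses (l1 : (1 < l)%N) (uW : uniq W).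
Hypothesis mW : forall w, (w \in W) = (w ^+ l == 1) && (w != 1).
Hypothesis sW : forall w, w ^+ l = 1 -> perm_eq [seq w * z | z <- s] s.

(** For each z the values P(x^i z) come from one fibre of z -> z^l. The product over all of [s]
    meets every fibre l times; this is the source of the l-th power, and it spares the choice of
    representatives of the fibres. *)
Lemma reldisc_norm_exp_le :
  `|reldisc P s W| ^+ l <=
  l`!%:R ^+ (2 * size s) * (\prod_(z <- s) max1 (evalQ P z)) ^+ (2 * l.-1 * l).
Proof.
have l0 : (0 < l)%N by apply: ltnW.
have [x prx] := C_prim_root_exists l0.
have xl i : (x ^+ i) ^+ l = 1 by rewrite exprAC (prim_expr_order prx) expr1n.
have nzx i : x ^+ i != 0.
  apply/eqP => x0; have := xl i; rewrite x0 expr0n gtn_eqF // => /eqP.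
  by rewrite eq_sym oner_eq0.
pose a z (i : 'I_l) := evalQ P (x ^+ i * z).
have -> : `|reldisc P s W| ^+ l =
    \prod_(z <- s) (\prod_(i < l) \prod_(j < l | (i < j)%N) `|a z j - a z i|) ^+ 2.
  under eq_bigr => z _.
    rewrite -(@prod_neq_lt_sqr _ _ (fun i j => `|a z j - a z i|)); last by move=> i j; apply: distrC.
    over.
  rewrite exchange_big /= -[l in LHS]card_ord -prodr_const; apply: eq_bigr => i _.
  (* For fixed i, the quotients x^j / x^i with j different from i enumerate the nontrivial l-th
     roots of unity. *)
  have permW : perm_eq [seq x ^+ (j : 'I_l) / x ^+ i | j <- [seq j <- index_enum 'I_l | j != i]] W.
    apply: uniq_perm => //.
      rewrite map_inj_uniq ?filter_uniq ?index_enum_uniq // => j k.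
      move=> /(mulIf _) -/(_ _)/eqP; rewrite invr_eq0 nzx => /(_ isT).
      by rewrite (eq_prim_root_expr prx) !modn_small // => /eqP/val_inj.
    move=> w; rewrite mW; apply/mapP/andP => [[j]|[/eqP wl w1]].
      rewrite mem_filter => /andP[nji _] ->; split.
        by rewrite exprMn exprVn !xl invr1 mulr1.
      apply: contraNneq nji => /divr1_eq/eqP.
      by rewrite (eq_prim_root_expr prx) !modn_small.
    have [|j Dj] := prim_rootP prx (x := w * x ^+ i).
      by rewrite exprMn wl xl mulr1.
    exists j; last by rewrite -Dj mulfK.
    rewrite mem_filter mem_index_enum andbT; apply: contraNneq w1 => ji.
    by apply/eqP/(mulIf (nzx i)); rewrite mul1r Dj ji.
  rewrite /reldisc -(perm_big _ (sW (xl i))) big_map normr_prod; apply: eq_bigr => z _.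
  rewrite normr_prod -(perm_big _ permW) big_map big_filter; apply: eq_bigr => j _.
  by rewrite /a distrC mulrA divfK.
have -> : l`!%:R ^+ (2 * size s) * (\prod_(z <- s) max1 (evalQ P z)) ^+ (2 * l.-1 * l)
  = \prod_(z <- s) (l`!%:R * \prod_(i < l) max1 (a z i) ^+ l.-1) ^+ 2.
  rewrite prodrXl big_split /= [in RHS]exprMn big_const_seq count_predT iter_mulr_1 -[in RHS]exprM.
  congr (_ * _); first by rewrite mulnC.
  rewrite exchange_big /=.
  have -> : \prod_(i < l) \prod_(z <- s) max1 (a z i) ^+ l.-1 =
            \prod_(i < l) \prod_(z <- s) max1 (evalQ P z) ^+ l.-1.
    apply: eq_bigr => i _; rewrite -[RHS](perm_big _ (sW (xl i))) big_map.
    by apply: eq_bigr => z _.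
  rewrite prodr_const card_ord prodrXl -!exprM; congr (_ ^+ _); ring.
elim: s => [|z t IHt]; first by rewrite !big_nil.
rewrite !big_cons; apply: ler_pM => //.
- apply: exprn_ge0; apply: prodr_ge0 => i _; apply: prodr_ge0 => j _; exact: normr_ge0.
- apply: prodr_ge0 => z' _; apply: exprn_ge0; apply: prodr_ge0 => i _; apply: prodr_ge0 => j _; exact: normr_ge0.
- apply: lerXn2r; rewrite ?nnegrE.
  + by apply: prodr_ge0 => i _; apply: prodr_ge0 => j _; exact: normr_ge0.
  + by rewrite mulr_ge0 // prodr_ge0 // => i _; rewrite exprn_ge0 // max1_ge0.
  + exact: vandermonde_norm_le.
Qed.

End UpperBound.

(** * Generation of a prime degree radical extension *)

(** The field of y has prime degree l over the field K of y^l, so there is no intermediate field,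
    and any [a] outside K generates it over K. *)
Lemma radical_in_adjoin (l d : nat) (r : rat) (y a : algC) :
  prime l -> (0 < d)%N -> y ^+ (d * l) = ratr r -> deg y = (d * l)%N ->
  Qadjoin y a -> ~ Qadjoin (y ^+ l) a ->
  exists (n : nat) (K : 'I_n -> {poly rat}), y = \sum_(k < n) evalQ (K k) (y ^+ l) * a ^+ k.
Proof.
move=> pr_l d0 yD degy [P Da] nKa; have l0 := prime_gt0 pr_l.
have [Qs [QsC [[|y1 []] // [Dy] genQs]]] := num_field_exists [:: y].
rewrite adjoin_seq1 in genQs.
have QsCP (Q : {poly rat}) x : QsC (map_poly (in_alg Qs) Q).[x] = evalQ Q (QsC x).
  rewrite -horner_map /evalQ -map_poly_comp; congr (_.[_]).
  by apply: eq_map_poly => c /=; rewrite rmorphZ_num rmorph1 mulr1.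
have over1 (q : {poly Qs}) : q \is a polyOver 1%VS ->
    exists Q : {poly rat}, q = map_poly (in_alg Qs) Q.
  move=> /polyOverP Oq; have c_ i := sig_eqW (vlineP _ _ (Oq i)).
  exists (\poly_(i < size q) sval (c_ i)).
  apply/polyP => i; rewrite coef_map coef_poly; case: ifP => [_|/negbT].
    by case: (c_ i) => c /= ->.
  by rewrite -leqNgt => szi; rewrite /= scale0r nth_default.
pose a1 := (map_poly (in_alg Qs) P).[y1].
have Da1 : QsC a1 = a by rewrite QsCP Dy -Da.
have yD1 : y1 ^+ (d * l) = (ratr r : Qs).
  by apply: (fmorph_inj QsC); rewrite rmorphXn /= Dy yD fmorph_rat.
pose K := <<1; y1 ^+ l>>%AS.
have memK v : v \in K -> exists Q, QsC v = evalQ Q (y ^+ l).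
  move=> /Fadjoin_polyP[q /over1[Q ->] ->]; exists Q.
  by rewrite QsCP rmorphXn /= Dy.
have yK : y1 ^+ l \in K by apply: memv_adjoin.
have genK (F : {subfield Qs}) : <<F; y1>>%VS = fullv.
  apply/eqP; rewrite eqEsubv subvf -genQs /=.
  by apply/FadjoinP; split; [apply: sub1v | apply: memv_adjoin].
(* The lower bound d l for the total degree and the upper bounds d and l for the two layers force
   equality everywhere. *)
have degD : (d * l <= \dim {:Qs})%N.
  rewrite -genQs dim_Fadjoin dimv1 muln1 -ltnS -size_minPoly.
  have [q Dq] := over1 _ (minPolyOver 1 y1).
  have [mu [Dmu mmu] dvmu] := minCpolyP y.
  have nzq : q != 0.
    by apply: contraTneq (monic_minPoly 1 y1) => q0; rewrite Dq q0 rmorph0 monicE lead_coef0 eq_sym oner_eq0.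
  have : mu %| q.
    rewrite -dvmu rootE -/(evalQ q y) -Dy -QsCP -Dq.
    by have /rootP-> := root_minPoly 1 y1; rewrite rmorph0.
  move=> /(dvdp_leq nzq); rewrite Dq size_map_poly -[X in (X < _)%N]degy /deg prednK.
    by rewrite Dmu size_map_poly.
  exact: ltnW (size_minCpoly y).
have dimK : (\dim K <= d)%N.
  rewrite dim_Fadjoin dimv1 muln1 -ltnS -size_minPoly.
  have O : 'X^d - (ratr r)%:P \is a polyOver (1%VS : {vspace Qs}).
    rewrite rpredB ?rpredX ?polyOverX // polyOverC -alg_num_field memvZ //.
    exact: memv_line.
  have := minPoly_dvdp O (x := y1 ^+ l); rewrite rootE !hornerE -exprM mulnC yD1 subrr eqxx => /(_ isT).
  move=> /dvdp_leq; rewrite size_XnsubC // => -> //.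
  by rewrite -size_poly_gt0 size_XnsubC.
have adK : (adjoin_degree K y1 <= l)%N.
  rewrite -ltnS -size_minPoly.
  have O : 'X^l - (y1 ^+ l)%:P \is a polyOver K.
    by rewrite rpredB ?rpredX ?polyOverX // polyOverC.
  have := minPoly_dvdp O (x := y1); rewrite rootE !hornerE subrr eqxx => /(_ isT).
  move=> /dvdp_leq; rewrite size_XnsubC // => -> //.
  by rewrite -size_poly_gt0 size_XnsubC.
have dimE : \dim {:Qs} = (adjoin_degree K y1 * \dim K)%N by rewrite -dim_Fadjoin genK.
have dKd : \dim K = d.
  apply/eqP; rewrite eqn_leq dimK -(leq_pmul2r l0) (leq_trans degD) // dimE mulnC.
  by rewrite leq_mul2l adK orbT.
have dQs : \dim {:Qs} = (d * l)%N.
  by apply/eqP; rewrite eqn_leq degD andbT dimE dKd mulnC leq_mul2l adK orbT.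
pose Ka := <<K; a1>>%AS.
have dimKa : \dim Ka = (adjoin_degree K a1 * d)%N by rewrite dim_Fadjoin dKd.
have dvl : (adjoin_degree K a1 %| l)%N.
  have : (d * l = adjoin_degree Ka y1 * (adjoin_degree K a1 * d))%N.
    by rewrite -dQs -dimKa -dim_Fadjoin genK.
  rewrite mulnA mulnC => /eqP; rewrite eqn_pmul2r // => /eqP->; exact: dvdn_mull.
have /orP[/eqP e1|/eqP el] : (adjoin_degree K a1 == 1%N) || (adjoin_degree K a1 == l).
- by move: pr_l => /primeP[_]; apply.
- case: nKa; have a1K : a1 \in K.
    have /eqP-> : K == Ka :> {vspace Qs}.
      by rewrite eqEdim subv_adjoin dimKa e1 mul1n dKd /=.
    exact: memv_adjoin.
  by have [Q DQ] := memK _ a1K; exists Q; rewrite -DQ Da1.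
have : y1 \in Ka.
  have /eqP-> : Ka == fullv :> {vspace Qs}.
    by rewrite eqEdim subvf dimKa el dQs mulnC /=.
  exact: memvf.
move=> /Fadjoin_polyP[q /polyOverP Oq Dq].
have K_ (k : 'I_(size q)) := sig_eqW (memK _ (Oq k)).
exists (size q), (fun k => sval (K_ k)).
transitivity (QsC q.[a1]); first by rewrite -Dq.
rewrite horner_coef rmorph_sum; apply: eq_bigr => k _ /=.
by rewrite rmorphM rmorphXn /= Da1; case: (K_ k) => Q /= ->.
Qed.

(** y is a polynomial in P(y) over the field of y^l. This relation passes to z and to w z, with
    equal coefficients since (w z)^l = z^l; equal values of P then give w z = z. The nonvanishing of
    the relative discriminant rests on this. *)
Lemma evalQ_conj_inj (l d : nat) (r : rat) (y : algC) (P : {poly rat}) (z w : algC) :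
  prime l -> (0 < d)%N -> r != 0 -> y ^+ (d * l) = ratr r -> deg y = (d * l)%N ->
  ~ Qadjoin (y ^+ l) (evalQ P y) ->
  z ^+ (d * l) = ratr r -> w ^+ l = 1 -> evalQ P z = evalQ P (w * z) -> w = 1.
Proof.
move=> pr_l d0 nzr yD degy nK zD wl Pzw.
have Py : Qadjoin y (evalQ P y) by exists P.
have [n [K DK]] := radical_in_adjoin pr_l d0 yD degy Py nK.
pose Q := \sum_(k < n) (K k \Po 'X^l) * P ^+ k - 'X.
have D0 : (0 < d * l)%N by rewrite muln_gt0 d0 prime_gt0.
have QE t : evalQ Q t = \sum_(k < n) evalQ (K k) (t ^+ l) * evalQ P t ^+ k - t.
  rewrite evalQB evalQX evalQ_sum; congr (_ - _); apply: eq_bigr => k _.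
  by rewrite evalQM evalQ_comp evalQXn evalQ_exp.
have Q0 t : t ^+ (d * l) = ratr r -> \sum_(k < n) evalQ (K k) (t ^+ l) * evalQ P t ^+ k = t.
  move=> tD; apply/eqP; rewrite -subr_eq0 -QE; apply/eqP.
  by apply: (evalQ_conj0 D0 yD degy tD); rewrite QE -DK subrr.
have wzD : (w * z) ^+ (d * l) = ratr r by rewrite exprMn [in w ^+ _]mulnC exprM wl expr1n mul1r.
have nzz : z != 0.
  apply: contraNneq nzr => z0; move: zD; rewrite z0 expr0n gtn_eqF // => /esym/eqP.
  by rewrite fmorph_eq0.
apply: (mulIf nzz); rewrite mul1r -[in LHS](Q0 _ wzD) -[in RHS](Q0 _ zD).
by apply: eq_bigr => k _; rewrite exprMn wl mul1r Pzw.
Qed.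

(** * The Mahler measure in a radical extension *)

(** The Mahler measure inside [algC], where the estimates are made; [mahler_modulus] carries it to
    R. *)
Definition mahlerC (f : {poly int}) : algC :=
  (`|lead_coef f|)%:~R *
  \prod_(z <- sval (closed_field_poly_normal (map_poly intr f : {poly algC}))) max1 z.

Lemma int_minpoly_lead_neq0 (a : algC) (f : {poly int}) :
  is_int_minpoly a f -> lead_coef f != 0.
Proof. by case=> cf _; rewrite lead_coef_eq0 -zcontents_eq0 cf. Qed.

Lemma mahlerC_conj (a : algC) (f : {poly int}) (N : nat) (t : seq algC) :
  is_int_minpoly a f -> \prod_(z <- t) ('X - z%:P) = minCpoly a ^+ N ->
  mahlerC f ^+ N = `|(lead_coef f)%:~R| ^+ N * \prod_(z <- t) max1 z.
Proof.
move=> Df E; have nzc := int_minpoly_lead_neq0 Df; case: Df => _ Df.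
rewrite /mahlerC exprMn intr_norm; congr (_ * _).
case: closed_field_poly_normal => s /= Ds.
have {Ds} Ds : minCpoly a = \prod_(z <- s) ('X - z%:P).
  have nzC : (lead_coef f)%:~R != 0 :> algC by rewrite intr_eq0.
  apply: (scalerI nzC); rewrite -Df {1}Ds lead_coef_map_inj //; exact: intr_inj.
rewrite -prodrXl; elim: N t E => [|N IHN] t.
  rewrite Ds expr0 => /(congr1 (fun p : {poly algC} => size p)); rewrite size_prod_XsubC size_poly1 => -[/size0nil->].
  by rewrite big_nil big1 // => z _; rewrite expr0.
move=> E; pose u := flatten (nseq N s).
have Eu : \prod_(z <- u) ('X - z%:P) = minCpoly a ^+ N.
  rewrite /u; elim: (N) => [|M IHM]; first by rewrite big_nil.
  by rewrite /= big_cat /= IHM Ds exprS.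
have permt : perm_eq t (s ++ u).
  by apply: prod_XsubC_eq; rewrite E big_cat /= Eu -Ds exprS.
rewrite (perm_big _ permt) big_cat /= -(IHN u Eu) -big_split /=.
by apply: eq_bigr => z _; rewrite exprS.
Qed.

Lemma int_of_Crat_Aint (x : algC) : x \in Crat -> x \in Aint -> x != 0 ->
  exists2 e : nat, (0 < e)%N & `|x| = e%:R.
Proof.
move=> Qx Ax nzx; have /intrP[n Dn] := Cint_rat_Aint Qx Ax.
exists `|n|%N; last by rewrite Dn natr_absz intr_norm.
by rewrite absz_gt0; move: nzx; rewrite Dn intr_eq0.
Qed.

Lemma pint_div_expn (p e k : nat) : prime p -> (0 < e)%N ->
  pint p (e%:R / p%:R ^+ k) -> (p ^ k %| e)%N.
Proof.
move=> pr_p e0; have p0 := prime_gt0 pr_p.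
have nze : (e%:R : rat) != 0 by rewrite pnatr_eq0 -lt0n.
have nzp : (p%:R : rat) != 0 by rewrite pnatr_eq0 -lt0n.
have -> : e%:R / p%:R ^+ k = ratr (e%:R / p%:R ^+ k) :> algC.
  by rewrite fmorph_div /= rmorphXn /= !ratr_nat.
rewrite pint_ratP // ?mulf_neq0 ?invr_eq0 ?expf_neq0 //.
rewrite pvalM ?invr_eq0 ?expf_neq0 // pvalV ?expf_neq0 // pvalX // !pval_nat (logn_prime _ pr_p) eqxx mul1r.
by rewrite subr_ge0 lez_nat pfactor_dvdn.
Qed.

Section RadicalHeightBound.
Variables (l d : nat) (r : rat) (y a : algC).
Local Notation D := (d * l)%N.
Hypotheses (pr_l : prime l) (d0 : (0 < d)%N).
Hypotheses (nzr : r != 0) (yD : y ^+ D = ratr r) (degy : deg y = D).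
Hypotheses (ya : Qadjoin y a) (yla : ~ Qadjoin (y ^+ l) a).

(** The values P(w y), for w an l-th root of unity, are l distinct conjugates of [a] by
    [evalQ_conj_inj]. *)
Lemma deg_ge_radical : (l <= deg a)%N.
Proof.
move: ya => [P Da]; move: yla; rewrite Da => nK.
have l0 := prime_gt0 pr_l; have D0 : (0 < D)%N by rewrite muln_gt0 d0.
have [s [us szs ms]] := exists_rootsC l0 (oner_neq0 algC).
pose rs := [seq evalQ P (w * y) | w <- s].
have sD w : w \in s -> (w * y) ^+ D = ratr r.
  by rewrite ms => /eqP wl; rewrite exprMn [in w ^+ _]mulnC exprM wl expr1n mul1r.
have nz0 w : w \in s -> w != 0.
  rewrite ms => wl; apply: contraTneq wl => ->; rewrite expr0n gtn_eqF //.
  by rewrite eq_sym oner_eq0.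
have urs : uniq rs.
  rewrite map_inj_in_uniq // => w v ws vs E.
  have nzw := nz0 w ws; apply/eqP; rewrite eq_sym -subr_eq0.
  have -> : v - w = (v / w - 1) * w by rewrite mulrBl divfK // mul1r.
  rewrite mulf_eq0 (negPf nzw) orbF subr_eq0; apply/eqP.
  apply: (evalQ_conj_inj pr_l d0 nzr yD degy nK (sD w ws)).
    by move: ws vs; rewrite !ms => /eqP wl /eqP vl; rewrite exprMn exprVn wl vl divr1.
  by rewrite mulrA divfK.
have : (size rs < size (minCpoly (evalQ P y)))%N.
  apply: max_poly_roots => //; first by rewrite minCpoly_eq0.
  by apply/allP => _ /mapP[w ws ->]; apply: (root_minCpoly_conj D0 yD degy); apply: sD.
by rewrite size_map szs /deg => lsz; rewrite -ltnS prednK // (leq_ltn_trans _ lsz).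
Qed.

Lemma deg_dvd_radical : (deg a %| D)%N.
Proof.
move: ya => [P ->]; have D0 : (0 < D)%N by rewrite muln_gt0 d0 prime_gt0.
have nzrC : ratr r != 0 :> algC by rewrite fmorph_eq0.
have [s [us szs ms]] := exists_rootsC D0 nzrC.
have [N _ <-] := prod_conj_exp D0 yD degy us szs ms P; exact: dvdn_mull.
Qed.

Lemma mahlerC_radical_ge (p q : nat) (u v : int) :
  prime p -> prime q -> p != q -> (D < p)%N -> (D < q)%N ->
  pval p r = d%:Z * u -> pval q r = d%:Z * v -> ~~ (l %| `|u|)%N -> ~~ (l %| `|v|)%N ->
  (p * q)%:R ^+ (d * l.-1) <=
  l`!%:R ^+ (2 * d) * mahlerC (int_minpoly a) ^+ (D %/ deg a * (2 * l.-1)).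
Proof.
move=> pr_p pr_q npq ltDp ltDq vp vq lu lv.
have Da := int_minpolyP a; set f := int_minpoly a in Da *.
move: ya => [P aP]; rewrite aP in Da *; have nK := yla; rewrite aP in nK.
have l0 := prime_gt0 pr_l; have l1 := prime_gt1 pr_l.
have D0 : (0 < D)%N by rewrite muln_gt0 d0.
have nzrC : ratr r != 0 :> algC by rewrite fmorph_eq0.
have [s [us szs ms]] := exists_rootsC D0 nzrC.
have [s1 [us1 szs1 ms1]] := exists_rootsC l0 (oner_neq0 algC).
pose W := rem 1 s1.
have uW : uniq W by apply: rem_uniq.
have mW w : (w \in W) = (w ^+ l == 1) && (w != 1).
  by rewrite (mem_rem_uniq _ us1) inE /= ms1 andbC.
have szW : size W = l.-1 by rewrite size_rem ?szs1 // ms1 expr1n.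
have sW w : w ^+ l = 1 -> perm_eq [seq w * z | z <- s] s.
  move=> wl; apply: (perm_rootsC_mul us ms).
    by rewrite mulnC exprM wl expr1n.
  apply/eqP => w0; move: wl; rewrite w0 expr0n gtn_eqF // => /eqP.
  by rewrite eq_sym oner_eq0.
have [N prodE ND] := prod_conj_exp D0 yD degy us szs ms P.
have dg0 : (0 < deg (evalQ P y))%N by move: D0; rewrite -ND muln_gt0 => /andP[].
have -> : (D %/ deg (evalQ P y))%N = N by rewrite -ND mulnK.
pose c : algC := (lead_coef f)%:~R.
have nzc : c != 0 by rewrite intr_eq0 (int_minpoly_lead_neq0 Da).
(* The characteristic polynomial is the N-th power of the minimal one, so c^N clears its
   denominators; it is used twice for each w. *)
pose E := c ^+ (N * (2 * size W)) * reldisc P s W.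
have nzE : E != 0.
  rewrite mulf_neq0 ?expf_neq0 // /reldisc prodf_seq_neq0; apply/allP => z zs /=.
  rewrite prodf_seq_neq0; apply/allP => w /=; rewrite mW => /andP[/eqP wl w1].
  rewrite subr_eq0; apply: contraNneq w1 => Ez; apply/eqP.
  by apply: (evalQ_conj_inj pr_l d0 nzr yD degy nK _ wl Ez); apply/eqP; rewrite -ms.
have QE : E \in Crat.
  rewrite rpredM //; first by rewrite rpredX // rpred_int.
  apply: reldisc_Crat => nu; first exact: (perm_rootsC_aut nu us ms).
  apply: perm_map_stable => //; first exact: fmorph_inj.
  move=> w; rewrite !mW => /andP[/eqP wl w1].
  by rewrite -rmorphXn /= wl rmorph1 eqxx /= fmorph_eq1.
have AE : E \in Aint.
  rewrite /E exprM; apply: reldisc_Aint.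
    by move=> w; rewrite mW => /andP[/eqP /sW].
  rewrite prodE; case: (Da) => _ Df.
  have -> : c ^+ N *: minCpoly (evalQ P y) ^+ N = map_poly intr (f ^+ N).
    by rewrite rmorphXn /= Df exprZn.
  by apply/polyOverP => i; rewrite coef_map /= Aint_int.
have [e e0 De] := int_of_Crat_Aint QE AE nzE.
have dvE (p' : nat) (u' : int) : prime p' -> (D < p')%N -> pval p' r = d%:Z * u' ->
    ~~ (l %| `|u'|)%N -> (p' ^ (d * l.-1) %| e)%N.
  move=> pr_p' ltDp' vp' lu'; apply: pint_div_expn => //.
  have mW1 w : w \in W -> w ^+ l = 1 by rewrite mW => /andP[/eqP].
  have := pint_reldisc pr_p' pr_l d0 nzr yD degy us szs ms mW1 ltDp' vp' lu' Da ND prodE.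
  rewrite -/c -/E szW -De.
  have [n Dn] : exists n : int, E = n%:~R by apply/intrP; apply: Cint_rat_Aint.
  rewrite Dn -intr_norm; case: (ger0P n) => // _.
  rewrite rmorphN /= mulNr -mulN1r => H; apply: pintM => //.
  by apply: pint_Aint => //; apply: rpredN1.
have pqe : ((p * q) ^ (d * l.-1) %| e)%N.
  rewrite expnMn Gauss_dvd ?(dvE p u) ?(dvE q v) //.
  by rewrite coprimeXl // coprimeXr // prime_coprime // dvdn_prime2.
apply: le_trans (_ : e%:R <= _).
  by rewrite -natrX ler_nat dvdn_leq.
have B0 : 0 <= mahlerC f ^+ N.
  rewrite exprn_ge0 // mulr_ge0 ?ler0z ?normr_ge0 // prodr_ge0 // => z _; exact: max1_ge0.
have DB : mahlerC f ^+ N = `|c| ^+ N * \prod_(z <- s) max1 (evalQ P z).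
  rewrite (mahlerC_conj (t := map (evalQ P) s) Da) ?big_map //.
rewrite -De /E normrM normrX (exprM `|c|) szW (exprM (mahlerC f)) DB exprMn [in leRHS]mulrCA.
rewrite ler_pM2l; last by rewrite !exprn_gt0 // normr_gt0.
(* The upper bound is available for the l-th power of the discriminant, so l-th powers are
   compared. *)
rewrite -(ler_pXn2r l0) ?nnegrE ?normr_ge0 //; last first.
  by rewrite mulr_ge0 ?exprn_ge0 // prodr_ge0 // => z _; exact: max1_ge0.
apply: le_trans (reldisc_norm_exp_le P l1 uW mW sW) _.
rewrite szs exprMn -!exprM mulnA; exact: lexx.
Qed.

End RadicalHeightBound.

(** * The real modulus *)

Section Modulus.
Variable R : realType.
Implicit Types (z w : algC) (q : rat).
Local Notation modulus := (@modulus R).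

Lemma modulus_ubound z q : `|z| <= ratr q ->
  ubound [set (ratr t : R) | t in [set t : rat | ratr t <= `|z|]] (ratr q).
Proof.
by move=> zq _ [t /= tz <-]; rewrite ler_rat -(ler_rat algC); apply: le_trans zq.
Qed.

Lemma modulus_has_ubound z :
  has_ubound [set (ratr t : R) | t in [set t : rat | ratr t <= `|z|]].
Proof.
exists (ratr (Num.Def.archi_bound `|z|)%:R); apply: modulus_ubound.
by rewrite ratr_nat ltW // archi_boundP.
Qed.

Lemma modulus_ge_rat z q : ratr q <= `|z| -> ratr q <= modulus z.
Proof. by move=> qz; apply: ub_le_sup; [apply: modulus_has_ubound | exists q]. Qed.

Lemma modulus_le_rat z q : `|z| <= ratr q -> modulus z <= ratr q.
Proof.
move=> zq; apply: ge_sup; last exact: modulus_ubound.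
by exists (ratr 0), 0 => //=; rewrite rmorph0 normr_ge0.
Qed.

Lemma modulus_ge0 z : 0 <= modulus z.
Proof. by rewrite -(rmorph0 (ratr : {rmorphism rat -> R})) modulus_ge_rat // rmorph0 normr_ge0. Qed.

Lemma modulus_rat z q : `|z| = ratr q -> modulus z = ratr q.
Proof. by move=> E; apply: le_anti; rewrite modulus_ge_rat ?modulus_le_rat ?E. Qed.

Lemma modulus_nat (n : nat) : modulus n%:R = n%:R.
Proof. by rewrite (@modulus_rat _ n%:R) ?ratr_nat ?normr_nat. Qed.

Lemma rat_algC_total z q : (ratr q <= `|z|) || (`|z| <= ratr q).
Proof. by rewrite real_leVge ?normr_real // Creal_Crat ?Crat_rat. Qed.

Lemma rat_gt_modulus z q : modulus z < ratr q -> `|z| <= ratr q.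
Proof.
move=> zq; have /orP[|//] := rat_algC_total z q.
by move=> /modulus_ge_rat; rewrite leNgt zq.
Qed.

Lemma rat_lt_modulus z q : ratr q < modulus z -> ratr q <= `|z|.
Proof.
move=> zq; have /orP[//|] := rat_algC_total z q.
by move=> /modulus_le_rat; rewrite leNgt zq.
Qed.

Lemma modulus_mono z w : `|z| <= `|w| -> modulus z <= modulus w.
Proof.
move=> zw; rewrite leNgt; apply/negP => /rat_in_itvoo[q]; rewrite in_itv /= => /andP[wq qz].
have := rat_gt_modulus wq; have := rat_lt_modulus qz => qz' wq'.
have : modulus z <= ratr q by apply: modulus_le_rat; apply: le_trans wq'.
by rewrite leNgt qz.
Qed.

Lemma modulusM z w : modulus (z * w) = modulus z * modulus w.
Proof.
have A0 := modulus_ge0 z; have B0 := modulus_ge0 w; have M0 := modulus_ge0 (z * w).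
set A := modulus z in A0 *; set B := modulus w in B0 *; set M := modulus _ in M0 *.
apply: le_anti; apply/andP; split; rewrite leNgt; apply/negP => lt.
(* As e <= 1, (A + e) (B + e) <= A B + e (A + B + 1), at most halfway from A B to M; rationals less
   than e above A and B contradict this. *)
- pose e := Num.min 1 ((M - A * B) / (A + B + 1) / 2).
  have S0 : 0 < A + B + 1 by rewrite ltr_wpDl // addr_ge0.
  have e0 : 0 < e by rewrite lt_min ltr01 !divr_gt0 ?subr_gt0.
  have e1 : e <= 1 by rewrite ge_min lexx.
  have e2 : e * (A + B + 1) <= (M - A * B) / 2.
    by rewrite -ler_pdivlMr // mulrAC ge_min lexx orbT.
  have [q] : exists q : rat, ratr q \in `]A, A + e[ by apply: rat_in_itvoo; rewrite ltrDl.
  have [t] : exists q : rat, ratr q \in `]B, B + e[ by apply: rat_in_itvoo; rewrite ltrDl.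
  rewrite !in_itv /= => /andP[Bt tB] /andP[Aq qA].
  have : M <= ratr (q * t).
    apply: modulus_le_rat; rewrite normrM rmorphM /=; apply: ler_pM => //.
      exact: rat_gt_modulus.
    exact: rat_gt_modulus.
  have : (ratr q : R) * ratr t <= (A + e) * (B + e).
    by apply: ler_pM; [exact: ltW (le_lt_trans A0 Aq) | exact: ltW (le_lt_trans B0 Bt) | exact: ltW | exact: ltW].
  rewrite rmorphM /=; nra.
- have AB0 : 0 < A * B by apply: le_lt_trans lt.
  have A1 : 0 < A by rewrite lt_neqAle A0 andbT; apply: contraTneq AB0 => <-; rewrite mul0r ltxx.
  have B1 : 0 < B by rewrite -(pmulr_rgt0 _ A1).
  (* (A - e) (B - e) >= A B - e (A + B), halfway from A B to M; [eA] and [eB] keep both factors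
     non-negative. *)
  pose e := (A * B - M) / (A + B) / 2.
  have S0 : 0 < A + B by rewrite addr_gt0.
  have e0 : 0 < e by rewrite !divr_gt0 ?subr_gt0.
  have eE : e * (A + B) = (A * B - M) / 2 by rewrite /e; field; rewrite gt_eqF.
  have eA : e <= A by rewrite -(ler_pM2r S0) eE; nra.
  have eB : e <= B by rewrite -(ler_pM2r S0) eE; nra.
  have [q] : exists q : rat, ratr q \in `]A - e, A[ by apply: rat_in_itvoo; rewrite ltrBlDr ltrDl.
  have [t] : exists q : rat, ratr q \in `]B - e, B[ by apply: rat_in_itvoo; rewrite ltrBlDr ltrDl.
  rewrite !in_itv /= => /andP[Bt tB] /andP[Aq qA].
  have q0 : 0 <= q by rewrite -(ler0q R); apply: ltW; apply: le_lt_trans Aq; rewrite subr_ge0.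
  have t0 : 0 <= t by rewrite -(ler0q R); apply: ltW; apply: le_lt_trans Bt; rewrite subr_ge0.
  have : ratr (q * t) <= M.
    apply: modulus_ge_rat; rewrite normrM rmorphM /=; apply: ler_pM; rewrite ?ler0q //.
      exact: rat_lt_modulus.
    exact: rat_lt_modulus.
  have : (A - e) * (B - e) <= ratr q * ratr t :> R.
    by apply: ler_pM; rewrite ?subr_ge0 //; exact: ltW.
  rewrite rmorphM /=; nra.
Qed.

Lemma modulus1 : modulus 1 = 1.
Proof. by rewrite -[1 in LHS]/(1%:R) modulus_nat. Qed.

Lemma modulusX z (n : nat) : modulus (z ^+ n) = modulus z ^+ n.
Proof.
by elim: n => [|n IHn]; [rewrite !expr0 modulus1 | rewrite !exprS modulusM IHn].
Qed.

Lemma modulus_max1 z : modulus (max1 z) = Num.max 1 (modulus z).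
Proof.
have mz : modulus `|z| = modulus z by apply: le_anti; rewrite !modulus_mono // normr_id.
rewrite /max1; have /orP[z1|z1] : (1 <= `|z|) || (`|z| <= 1).
- by rewrite real_leVge ?normr_real ?rpred1.
- rewrite max_r // mz max_r // -modulus1; apply: modulus_mono; rewrite normr1 //.
- rewrite max_l // modulus1 max_l // -modulus1; apply: modulus_mono; rewrite normr1 //.
Qed.

Lemma modulus_prod (I : Type) (s : seq I) (F : I -> algC) :
  modulus (\prod_(i <- s) F i) = \prod_(i <- s) modulus (F i).
Proof.
by elim/big_rec2: _ => [|i x y _ <-]; [apply: modulus1 | rewrite modulusM].
Qed.

Lemma mahler_modulus (f : {poly int}) : mahler R f = modulus (mahlerC f).
Proof.
rewrite /mahler /mahlerC modulusM modulus_prod; congr (_ * _).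
  by rewrite -natr_absz modulus_nat natr_absz.
by apply: eq_bigr => z _; rewrite modulus_max1.
Qed.

End Modulus.

(** * Heights *)

Lemma deg_gt0 (a : algC) : (0 < deg a)%N.
Proof. by rewrite /deg -ltnS prednK ?size_minCpoly // (ltnW (size_minCpoly a)). Qed.

Lemma size_int_minpoly (a : algC) (f : {poly int}) :
  is_int_minpoly a f -> size f = (deg a).+1.
Proof.
move=> Df; have nzc := int_minpoly_lead_neq0 Df; case: Df => _ Df.
have nzC : (lead_coef f)%:~R != 0 :> algC by rewrite intr_eq0.
rewrite /deg prednK ?(ltnW (size_minCpoly a)) // -(size_scale _ nzC) -Df.
by rewrite size_map_inj_poly //; apply: intr_inj.
Qed.

(** The exponent n - 1, not n, matches the factor d (l - 1) of the discriminant bound, which then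
    cancels and leaves exactly ln l / l. *)
Lemma fact_le_exp_pred (n : nat) : (n`! <= n ^ n.-1)%N.
Proof.
case: n => // n; rewrite /=; elim: n => // n IHn.
rewrite factS expnS leq_mul2l /=; apply: leq_trans IHn _.
by case: (n) => // m; rewrite leq_exp2r.
Qed.

Section Heights.
Variable R : realType.
Local Notation height := (@height R).
Local Notation mahler := (@mahler R).

Lemma mahler_ge1 (a : algC) : 1 <= mahler (int_minpoly a).
Proof.
have nzc := int_minpoly_lead_neq0 (int_minpolyP a).
apply: mulr_ege1; first by rewrite -natr_absz ler1n absz_gt0.
elim/big_ind: _ => // [x y x1 y1|z _]; last by rewrite le_max lexx.
exact: mulr_ege1.
Qed.

Lemma ln_mahler (a : algC) : ln (mahler (int_minpoly a)) = (deg a)%:R * height a.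
Proof. by rewrite /height mulrC divfK // pnatr_eq0 -lt0n deg_gt0. Qed.

Lemma height_ge0 (a : algC) : 0 <= height a.
Proof. by rewrite /height divr_ge0 // ln_ge0 // mahler_ge1. Qed.

Lemma height_radical_ge (l d p q : nat) (r : rat) (y a : algC) (u v : int) :
  prime l -> (0 < d)%N -> r != 0 -> y ^+ (d * l) = ratr r -> deg y = (d * l)%N ->
  Qadjoin y a -> ~ Qadjoin (y ^+ l) a ->
  prime p -> prime q -> p != q -> (d * l < p)%N -> (d * l < q)%N ->
  pval p r = d%:Z * u -> pval q r = d%:Z * v -> ~~ (l %| `|u|)%N -> ~~ (l %| `|v|)%N ->
  (ln p%:R + ln q%:R) / (2 * l%:R) - ln l%:R / l%:R <= height a.
Proof.
move=> pr_l d0 nzr yD degy ya yla pr_p pr_q npq ltp ltq vp vq lu lv.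
have l0 := prime_gt0 pr_l; have p0 := prime_gt0 pr_p; have q0 := prime_gt0 pr_q.
have := mahlerC_radical_ge pr_l d0 nzr yD degy ya yla pr_p pr_q npq ltp ltq vp vq lu lv.
have /dvdnP[N DN] := deg_dvd_radical pr_l d0 nzr yD degy ya.
rewrite DN mulnK ?deg_gt0 //; set f := int_minpoly a => H.
have M1 : 1 <= mahler f by apply: mahler_ge1.
have M0 : 0 < mahler f by apply: lt_le_trans M1.
have {}H : (p * q)%:R ^+ (d * l.-1) <= l`!%:R ^+ (2 * d) * mahler f ^+ (N * (2 * l.-1)) :> R.
  rewrite mahler_modulus -!(modulus_nat R) -!modulusX -modulusM; apply: modulus_mono.
  rewrite !ger0_norm ?exprn_ge0 ?ler0n //; apply: le_trans H.
  by rewrite exprn_ge0.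
have {}H : (p * q)%:R ^+ (d * l.-1) <= l%:R ^+ (2 * (d * l.-1)) * mahler f ^+ (N * (2 * l.-1)) :> R.
  apply: le_trans H _; rewrite ler_pM2r ?exprn_gt0 //.
  have -> : (2 * (d * l.-1) = l.-1 * (2 * d))%N by lia.
  by rewrite (exprM l%:R) -!natrX ler_nat leq_exp2r ?muln_gt0 ?d0 // fact_le_exp_pred.
have pq0 : 0 < (p * q)%:R :> R by rewrite ltr0n muln_gt0 p0.
have lR : 0 < l%:R :> R by rewrite ltr0n.
move: H; rewrite -ler_ln ?posrE ?mulr_gt0 ?exprn_gt0 // lnM ?posrE ?exprn_gt0 // !lnXn //.
rewrite -!(mulr_natr (ln _)) [(p * q)%:R]natrM lnM ?posrE ?ltr0n // ln_mahler => H.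
have l1 := prime_gt1 pr_l; have l10 : 0 < (l.-1)%:R :> R by rewrite ltr0n -ltnS prednK.
have dR : 0 < d%:R :> R by rewrite ltr0n.
have NE : N%:R * (deg a)%:R = d%:R * l%:R :> R by rewrite -!natrM DN.
have {}H : ln p%:R + ln q%:R <= 2 * ln l%:R + 2 * l%:R * height a.
  have dl0 : 0 < (d * l.-1)%:R :> R by rewrite natrM mulr_gt0.
  rewrite -(ler_pM2r dl0); apply: le_trans H _; rewrite !natrM.
  have -> : (deg a)%:R * height a * (N%:R * (2 * l.-1%:R)) = 2 * (d%:R * l%:R) * l.-1%:R * height a.
    by rewrite -NE; ring.
  by rewrite le_eqVlt; apply/orP; left; apply/eqP; ring.
rewrite lerBlDr ler_pdivrMr ?mulr_gt0 //; apply: le_trans H _.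
rewrite le_eqVlt; apply/orP; left; apply/eqP; field; exact: lt0r_neq0.
Qed.

Lemma norm_coef_prod_XsubC (s : seq algC) (i : nat) :
  `|(\prod_(z <- s) ('X - z%:P))`_i| <= \prod_(z <- s) (1 + `|z|).
Proof.
elim: s i => [|z s IHs] i; first by rewrite !big_nil coef1; case: (i == 0)%N; rewrite ?normr1 ?normr0.
rewrite !big_cons mulrBl coefB mul_polyC coefZ mulrDl mul1r coefXM.
apply: le_trans (ler_normB _ _) _; apply: lerD.
  by case: ifP => _ //; rewrite normr0 prodr_ge0 // => t _; rewrite addr_ge0.
by rewrite normrM ler_pM.
Qed.

(** A coefficient is at most the leading one times the product of the 1 + |z|, and 1 + |z| <= 2
    max(1, |z|). *)
Lemma coef_int_minpoly_le (a : algC) (i : nat) :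
  (absz (int_minpoly a)`_i)%:R <= 2 ^+ deg a * mahler (int_minpoly a).
Proof.
have Df := int_minpolyP a; set f := int_minpoly a in Df *.
have szf := size_int_minpoly Df; have nzc := int_minpoly_lead_neq0 Df.
rewrite mahler_modulus -(modulus_nat R 2) -(modulus_nat R (absz f`_i)) -modulusX -modulusM.
apply: modulus_mono; rewrite normr_nat natr_absz intr_norm.
have -> : (f`_i)%:~R = (map_poly intr f : {poly algC})`_i by rewrite coef_map.
rewrite /mahlerC; case: closed_field_poly_normal => s /= Ds.
have lcE : lead_coef (map_poly intr f : {poly algC}) = (lead_coef f)%:~R.
  by rewrite lead_coef_map_inj //; apply: intr_inj.
have szs : size s = deg a.
  have : size (map_poly intr f : {poly algC}) = (deg a).+1.
    by rewrite size_map_inj_poly //; apply: intr_inj.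
  by rewrite Ds size_scale ?lcE ?intr_eq0 // size_prod_XsubC => -[].
rewrite Ds lcE coefZ normrM [leRHS]ger0_norm; last first.
  rewrite mulr_ge0 ?exprn_ge0 // mulr_ge0 ?ler0z ?normr_ge0 // prodr_ge0 // => z _.
  exact: max1_ge0.
rewrite intr_norm mulrCA ler_wpM2l ?normr_ge0 //; apply: le_trans (norm_coef_prod_XsubC _ _) _.
have -> : 2 ^+ deg a = \prod_(z <- s) 2 :> algC by rewrite big_const_seq count_predT szs iter_mulr_1.
rewrite -big_split /=; elim: (s) => [|z t IHt]; first by rewrite !big_nil.
rewrite !big_cons; apply: ler_pM.
- by rewrite addr_ge0.
- by apply: prodr_ge0 => x _; rewrite addr_ge0.
- by rewrite mulr_natl mulr2n lerD ?max1_ge1 ?max1_ge_norm.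
- exact: IHt.
Qed.

(** Northcott's theorem: degree and height bound the coefficients of the integral minimal
    polynomial, and [g] enumerates the roots of the finitely many candidates. *)
Lemma finite_bounded_height (D : nat) (B : R) :
  finite_set [set a | (deg a <= D)%N /\ height a <= B].
Proof.
pose K := Num.Def.archi_bound (2 ^+ D * expR (D%:R * `|B|)).
(* Coefficients in [-K, K] are stored shifted by K. *)
pose poly_of (t : {ffun 'I_D.+1 -> 'I_(K.*2.+1)}) : {poly int} :=
  \poly_(i < D.+1) ((t (inord i) : nat)%:Z - K%:Z).
pose g (x : {ffun 'I_D.+1 -> 'I_(K.*2.+1)} * 'I_D.+1) : algC :=
  nth 0 (sval (closed_field_poly_normal (map_poly intr (poly_of x.1) : {poly algC}))) x.2.
apply: (@sub_finite_set _ _ [set g x | x in setT]); last first.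
  by apply: finite_image; apply: finite_finset.
move=> a /= [aD hB]; have Df := int_minpolyP a; set f := int_minpoly a in Df.
have szf := size_int_minpoly Df; have nzc := int_minpoly_lead_neq0 Df.
have M0 : 0 < mahler f by apply: lt_le_trans (mahler_ge1 a).
have coefK i : (absz (f`_i)%R <= K)%N.
  rewrite -(ler_nat R); apply: le_trans (coef_int_minpoly_le a i) _.
  apply: ltW; apply: le_lt_trans (archi_boundP _); last by rewrite mulr_ge0 ?exprn_ge0 ?expR_ge0.
  apply: ler_pM; rewrite ?exprn_ge0 ?(ltW M0) //.
    by rewrite ler_weXn2l // ler1n.
  rewrite -ler_ln ?posrE ?expR_gt0 // expRK ln_mahler; apply: ler_pM => //.
  + exact: height_ge0.
  + by rewrite ler_nat.
  + by apply: le_trans hB (ler_norm _).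
pose t := [ffun i : 'I_D.+1 => inord (absz (f`_i + K%:Z)) : 'I_(K.*2.+1)].
have tE : poly_of t = f.
  apply/polyP => i; rewrite coef_poly; case: ltnP => [ltiD|leDi]; last first.
    by rewrite nth_default // szf (leq_trans _ leDi).
  have Ki := coefK i.
  rewrite ffunE inordK ?inordK //; last by lia.
  by lia.
pose s := sval (closed_field_poly_normal (map_poly intr f : {poly algC})).
have Ds : map_poly intr f = lead_coef (map_poly intr f : {poly algC}) *: \prod_(z <- s) ('X - z%:P).
  by rewrite /s; case: closed_field_poly_normal.
have nzlc : lead_coef (map_poly intr f : {poly algC}) != 0.
  rewrite lead_coef_map_inj //; last exact: intr_inj.
  by rewrite intr_eq0.
have sa : a \in s.
  rewrite -root_prod_XsubC -(rootZ _ _ nzlc) -Ds; case: Df => _ ->.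
  by rewrite rootZ ?intr_eq0 // root_minCpoly.
have szs : size s = deg a.
  have : size (map_poly intr f : {poly algC}) = (deg a).+1.
    by rewrite size_map_inj_poly //; apply: intr_inj.
  by rewrite Ds size_scale // size_prod_XsubC => -[].
have ias : (index a s < D.+1)%N by rewrite ltnS (leq_trans _ aD) // -szs index_size.
exists (t, Ordinal ias) => //; rewrite /g /= tE -/s nth_index //.
Qed.

End Heights.

(** * Heights of radicals *)

(** The constant coefficient of the minimal polynomial is a product of deg y numbers of absolute
    value r^(1/D). The D-th power of its absolute value is thus r^(deg y), and the last hypothesis
    gives D | deg y. *)
Lemma deg_radical (D : nat) (r : rat) (y : algC) :
  (0 < D)%N -> 0 < r -> y ^+ D = ratr r ->
  (forall (k : nat) (x : rat), 0 < x -> x ^+ D = r ^+ k -> (D %| k)%N) -> deg y = D.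
Proof.
move=> D0 r0 yD irr; have [p [Dp mp] dvp] := minCpolyP y.
have nzr : r != 0 by rewrite gt_eqF.
have E : map_poly ratr ('X^D - r%:P) = 'X^D - (ratr r)%:P :> {poly algC}.
  by rewrite rmorphB /= map_polyXn map_polyC.
have pdv : p %| 'X^D - r%:P by rewrite -dvp E rootE !hornerE yD subrr.
have le_deg : (deg y <= D)%N.
  rewrite -ltnS /deg prednK ?(ltnW (size_minCpoly y)) // Dp size_map_poly.
  rewrite -(size_XnsubC r D0); apply: dvdp_leq => //.
  by rewrite -size_poly_gt0 size_XnsubC.
have [s Ds] := closed_field_poly_normal (minCpoly y).
rewrite (monicP (minCpoly_monic y)) scale1r in Ds.
have szs : size s = deg y by rewrite /deg Ds size_prod_XsubC.
have sD z : z \in s -> z ^+ D = ratr r.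
  rewrite -root_prod_XsubC -Ds Dp => pz; move: pdv => /dvdpP[q Dq].
  have : root (map_poly ratr ('X^D - r%:P)) z by rewrite Dq rmorphM rootM pz orbT.
  by rewrite E rootE !hornerE subr_eq0 => /eqP.
have c0 : `|ratr p`_0| ^+ D = ratr r ^+ deg y :> algC.
  have -> : ratr p`_0 = \prod_(z <- s) - z :> algC.
    have := congr1 (fun q : {poly algC} => q.[0]) Ds.
    rewrite /= Dp horner_coef0 coef_map /= => ->; rewrite horner_prod.
    by apply: eq_bigr => z _; rewrite !hornerE.
  rewrite normr_prod -prodrXl.
  transitivity (\prod_(z <- s) (ratr r : algC)).
    rewrite !big_seq; apply: eq_bigr => z zs.
    by rewrite normrN -normrX sD // ger0_norm // ler0q ltW.
  by rewrite big_const_seq count_predT szs iter_mulr_1.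
have {}c0 : `|p`_0| ^+ D = r ^+ deg y.
  apply: (fmorph_inj (ratr : {rmorphism rat -> algC})).
  by rewrite /= !rmorphXn /= ratr_norm.
have p00 : 0 < `|p`_0|.
  rewrite normr_gt0; apply: contraTneq r0 => p0; move: c0.
  by rewrite p0 normr0 expr0n gtn_eqF // => /esym/eqP; rewrite expf_eq0 (negPf nzr) andbF.
by apply/eqP; rewrite eqn_leq le_deg dvdn_leq ?deg_gt0 // (irr _ _ p00 c0).
Qed.

Lemma is_int_minpoly_radical (D A B : nat) (y : algC) :
  (0 < D)%N -> (0 < B)%N -> coprime A B -> y ^+ D = A%:R / B%:R -> deg y = D ->
  is_int_minpoly y (B%:Z *: 'X^D - A%:Z%:P).
Proof.
move=> D0 B0 cAB yD degy.
have nzB : B%:R != 0 :> algC by rewrite pnatr_eq0 -lt0n.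
set f : {poly int} := _ - _.
have szA : (size (- A%:Z%:P : {poly int}) < size (B%:Z *: 'X^D : {poly int}))%N.
  rewrite size_polyN size_scale ?eqz_nat -?lt0n // size_polyXn ltnS.
  by apply: leq_trans (size_polyC_leq1 _) _.
have lf : lead_coef f = B%:Z.
  by rewrite /f lead_coefDl // lead_coefZ lead_coefXn mulr1.
split.
  have cA (i : nat) : (zcontents f %| f`_i)%Z.
    have := dvdz_contents (zcontents f) f; rewrite dvdzz => /esym/polyOverP; exact.
  have := cA D; rewrite /f coefB coefZ coefXn eqxx mulr1 coefC gtn_eqF // subr0 => dB.
  have := cA 0%N; rewrite /f coefB coefZ coefXn eq_sym gtn_eqF // mulr0 coefC eqxx sub0r => dA.
  have : (`|zcontents f| %| gcdn A B)%N.
    by rewrite dvdn_gcd; move: dA dB; rewrite !dvdzE abszN /= => -> ->.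
  rewrite (eqP cAB) dvdn1 => /eqP c1.
  have := sgz_contents f; rewrite lf.
  by case: (zcontents f) c1 => n; [move=> /= -> | move=> _; case: (B) B0].
rewrite lf (@minCpoly_radical D (A%:R / B%:R)) //; last by rewrite fmorph_div /= !ratr_nat.
rewrite /f rmorphB /= map_polyZ /= map_polyXn map_polyC /= scalerBr; congr (_ - _).
rewrite -mul_polyC -polyCM fmorph_div /= !ratr_nat mulrC; congr _%:P.
by rewrite -!pmulrn divfK.
Qed.

(** All conjugates have absolute value (A / B)^(1/D) >= 1, so the Mahler measure of B X^D - A is the
    absolute value A of its constant term. *)
Lemma height_radical (R : realType) (D A B : nat) (y : algC) :
  (0 < D)%N -> (0 < B)%N -> (B <= A)%N -> coprime A B -> y ^+ D = A%:R / B%:R -> deg y = D ->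
  height R y = ln A%:R / D%:R.
Proof.
move=> D0 B0 leBA cAB yD degy.
have Df := is_int_minpoly_radical D0 B0 cAB yD degy.
rewrite /height degy; congr (ln _ / _).
rewrite (int_minpoly_unique (int_minpolyP y) Df) mahler_modulus -modulus_nat; congr modulus.
set f : {poly int} := _ - _ in Df *.
have nzlf := int_minpoly_lead_neq0 Df; case: (Df) => _ Ef.
have nzlc : lead_coef (map_poly intr f : {poly algC}) != 0.
  by rewrite lead_coef_map_inj ?intr_eq0 //; apply: intr_inj.
have lcE : lead_coef (map_poly intr f : {poly algC}) = (lead_coef f)%:~R.
  by rewrite lead_coef_map_inj //; apply: intr_inj.
rewrite /mahlerC intr_norm; case: closed_field_poly_normal => s /= Ds.
have minE := @minCpoly_radical D (A%:R / B%:R) y D0.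
rewrite fmorph_div /= !ratr_nat in minE; have {}minE := minE yD degy.
have sz z : z \in s -> max1 z = `|z|.
  rewrite -root_prod_XsubC -(rootZ _ _ nzlc) -Ds Ef rootZ ?intr_eq0 // minE.
  rewrite rootE !hornerE subr_eq0 => /eqP zD.
  rewrite /max1 max_r // -(@ler_pXn2r _ D) ?nnegrE //.
  rewrite expr1n -normrX zD ger0_norm ?divr_ge0 // ler_pdivlMr ?ltr0n // mul1r.
  by rewrite ler_nat.
have -> : \prod_(z <- s) max1 z = `|\prod_(z <- s) - z|.
  by rewrite normr_prod !big_seq; apply: eq_bigr => z zs; rewrite sz // normrN.
rewrite -normrM; have := congr1 (fun q : {poly algC} => q.[0]) Ds.
rewrite lcE /= hornerZ horner_prod; under eq_bigr do rewrite !hornerE.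
move=> <-; rewrite (horner_map _ f 0) /= /f !hornerE expr0n gtn_eqF // mulr0 sub0r.
by rewrite rmorphN normrN normr_nat.
Qed.

(** * Primes in short logarithmic intervals *)

(** Legendre's formula: floor(2m / p^k) - 2 floor(m / p^k) is 0 or 1 for each k, and 0 once p^k >
    2m. *)
Lemma logn_central_bin (p m : nat) : prime p -> (0 < m)%N ->
  (p ^ logn p 'C(m.*2, m) <= m.*2)%N.
Proof.
move=> pr_p m0; have p1 := prime_gt1 pr_p; have m20 : (0 < m.*2)%N by rewrite double_gt0.
apply: leq_trans (trunc_logP p1 m20); rewrite leq_exp2l //.
set L := trunc_log p m.*2.
have lem : (m <= m.*2)%N by rewrite -addnn leq_addr.
have E : (logn p 'C(m.*2, m) + 2 * logn p m`! = logn p m.*2`!)%N.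
  rewrite -(bin_fact lem) -addnn addnK !lognM ?muln_gt0 ?fact_gt0 ?bin_gt0 ?leq_addr //.
  by rewrite mul2n -addnn.
have ext : (\sum_(1 <= k < m.+1) m %/ p ^ k = \sum_(1 <= k < m.*2.+1) m %/ p ^ k)%N.
  rewrite [RHS](@big_cat_nat _ _ _ m.+1) //=.
  rewrite [X in (_ = _ + X)%N]big_nat_cond [X in (_ = _ + X)%N]big1 ?addn0 // => k /andP[/andP[mk _] _].
  by rewrite divn_small // (ltn_trans mk) // ltn_expl.
have : (logn p m.*2`! <= 2 * logn p m`! + L)%N.
  rewrite !logn_fact // ext big_distrr /=.
  apply: leq_trans (_ : \sum_(1 <= k < m.*2.+1) (2 * (m %/ p ^ k) + (k <= L)) <= _)%N.
    apply: leq_sum => k _; case: (leqP k L) => kL.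
      have pk : (0 < p ^ k)%N by rewrite expn_gt0 prime_gt0.
      rewrite -ltnS ltn_divLR // -addnn.
      have := ltn_ceil m pk; nia.
    rewrite divn_small // ltnNge; apply/negP => /(trunc_log_max p1).
    by rewrite leqNgt kL.
  rewrite big_split /= leq_add2l -big_mkcond /= sum1_count -size_filter.
  apply: leq_trans (uniq_leq_size (s2 := iota 1 L) _ _) _; rewrite ?filter_uniq ?iota_uniq ?size_iota //.
  move=> k; rewrite mem_filter !mem_iota => /andP[kL /andP[k1 _]].
  by rewrite k1 add1n ltnS.
by rewrite -E addnC leq_add2l.
Qed.

Lemma central_bin_ge (m : nat) : (2 ^ m <= 'C(m.*2, m))%N.
Proof.
elim: m => // m IHm; rewrite doubleS binS.
have H1 : ('C(m.*2, m) <= 'C(m.*2.+1, m.+1))%N by rewrite binS leq_addl.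
have H2 : ('C(m.*2.+1, m.+1) = 'C(m.*2.+1, m))%N.
  rewrite -bin_sub; last by rewrite ltnS -addnn leq_addr.
  by congr 'C(_, _); rewrite subSS -addnn addnK.
rewrite -H2 addnn -mul2n expnS leq_mul2l /=.
exact: leq_trans IHm H1.
Qed.

(** Let m = (N+1) s. If C(2m, m) had at most N+1 prime divisors, then 2^m <= C(2m, m) <= (2m)^(N+1)
    < 2^(s (N+1)) = 2^m. So it has at least N+2, all at most 2m, and at most N of them are at most
    N. *)
Lemma two_primes_between (N s : nat) : (0 < s)%N -> (2 * (N.+1 * s) < 2 ^ s)%N ->
  exists p q : nat, [/\ prime p, prime q, (N < q)%N, (q < p)%N & (p <= 2 * (N.+1 * s))%N].
Proof.
move=> s0 H; set m := (N.+1 * s)%N in H *.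
have m0 : (0 < m)%N by rewrite muln_gt0.
set C := 'C(m.*2, m).
have C0 : (0 < C)%N by rewrite bin_gt0 -addnn leq_addr.
have Cle : (C <= m.*2 ^ size (primes C))%N.
  rewrite {1}(prod_prime_decomp C0) prime_decompE big_map /=.
  have : all prime (primes C) by apply/allP => p; rewrite mem_primes => /andP[].
  elim: (primes C) => [|p t IHt] /=; first by rewrite big_nil.
  by move=> /andP[pr_p /IHt]; rewrite big_cons expnS; apply: leq_mul; apply: logn_central_bin.
have dvC p : p \in primes C -> prime p /\ (p <= m.*2)%N.
  move=> pC; have pr_p : prime p by move: pC; rewrite mem_primes => /andP[].
  split=> //; apply: leq_trans (logn_central_bin pr_p m0); rewrite -/C.
  by rewrite -{1}[p]expn1 leq_exp2l ?prime_gt1 // logn_gt0.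
have szC : (N.+1 < size (primes C))%N.
  rewrite ltnNge; apply/negP => szC.
  have : (2 ^ m <= m.*2 ^ N.+1)%N.
    apply: leq_trans (central_bin_ge m) _; apply: leq_trans Cle _.
    by rewrite leq_exp2l // -addnn -(addn1 1) leq_add.
  by rewrite {1}/m mulnC expnM leq_exp2r // leqNgt -mul2n H.
pose big := [seq p <- primes C | (N < p)%N].
have szbig : (1 < size big)%N.
  have := count_predC (fun p => N < p)%N (primes C); rewrite -size_filter -/big.
  have : (count (predC (fun p => N < p)%N) (primes C) <= N)%N.
    rewrite -size_filter.
    apply: leq_trans (uniq_leq_size (s2 := iota 1 N) _ _) _; rewrite ?filter_uniq ?primes_uniq ?size_iota //.
    move=> k; rewrite mem_filter mem_iota /= -leqNgt => /andP[kN /dvC[pk _]].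
    by rewrite prime_gt0 // add1n ltnS.
  by move: szC; lia.
have sbig : sorted ltn big by apply: sorted_filter; [exact: ltn_trans | exact: sorted_primes].
have mbig p : p \in big -> [/\ prime p, (N < p)%N & (p <= 2 * m)%N].
  by rewrite mem_filter mul2n => /andP[Np /dvC[]].
case: big szbig sbig mbig => [|q [|p t]] //= _ /andP[qp _] mb.
have [|pr_q Nq _] := mb q; first by rewrite mem_head.
have [|pr_p _ pm] := mb p; first by rewrite !inE eqxx orbT.
by exists p, q.
Qed.

Lemma double_exp_gt (j : nat) : (2 * (2 ^ j * (2 * j + 6)) < 2 ^ (2 * j + 6))%N.
Proof.
have H : (2 * j + 6 < 2 ^ (j + 5))%N.
  elim: j => // j IHj; rewrite addSn expnS.
  by apply: leq_ltn_trans (_ : 2 * (2 * j + 6) < _)%N; [lia | rewrite ltn_pmul2l].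
have -> : (2 ^ (2 * j + 6) = 2 * (2 ^ j * 2 ^ (j + 5)))%N.
  by rewrite -expnD -expnS; congr (_ ^ _)%N; lia.
by rewrite ltn_pmul2l // ltn_pmul2l // expn_gt0.
Qed.

Lemma exists_two_primes (R : realType) (e : R) : 0 < e -> exists T0 : R, forall T : R, T0 <= T ->
  exists p q : nat, [/\ prime p, prime q, (q < p)%N, T <= ln q%:R & ln p%:R <= (1 + e) * T].
Proof.
move=> e0; exists (Num.max 1 (256 / e ^+ 2)) => T; rewrite ge_max => /andP[T1 Te].
have T0 : 0 < T by apply: lt_le_trans T1.
pose N := (Num.Def.trunc (expR T)).+1.
have /andP[N1 N2] := truncn_itv (expR_ge0 T); rewrite -/N in N2.
(* j exceeds 2 (T + 1), so 2^j >= exp(j / 2) >= exp(T + 1) >= N + 1. *)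
pose j := (Num.Def.trunc (2 * (T + 1))).+1.
have /andP[j1 j2] : ((Num.Def.trunc (2 * (T + 1)))%:R <= 2 * (T + 1) < j%:R).
  by apply: truncn_itv; rewrite mulr_ge0 // addr_ge0 // ltW.
have eT1 : 2 <= expR T by apply: le_trans (expR_ge1Dx T); lra.
have half : expR (1 / 2) <= 2 :> R.
  have := expR_ge1Dx (- (1 / 2) : R); rewrite expRN => h.
  rewrite -[expR _]invrK -[leRHS]invrK lef_pV2 ?posrE ?invr_gt0 ?expR_gt0 //.
  apply: le_trans h; lra.
have Nj : (N.+1 <= 2 ^ j)%N.
  rewrite -(ler_nat R) natrX.
  apply: le_trans (_ : expR (1 / 2) ^+ j <= _); last by rewrite lerXn2r ?nnegrE ?expR_ge0.
  rewrite -expRM_natl.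
  apply: le_trans (_ : expR (T + 1) <= _); last by rewrite ler_expR; lra.
  have : 1 + 1 <= expR 1 :> R by apply: expR_ge1Dx.
  rewrite expRD -[N.+1]addn2 natrD => e1; nra.
pose s := (2 * j + 6)%N.
have Hs : (2 * (N.+1 * s) < 2 ^ s)%N.
  apply: leq_ltn_trans (double_exp_gt j).
  by rewrite leq_mul2l leq_mul2r Nj !orbT.
have s0 : (0 < s)%N by rewrite addn_gt0 orbT.
have [p [q [pr_p pr_q Nq qp ple]]] := two_primes_between s0 Hs.
have p0 : 0 < p%:R :> R by rewrite ltr0n prime_gt0.
have q0 : 0 < q%:R :> R by rewrite ltr0n prime_gt0.
exists p, q; split => //.
  rewrite -[T]expRK ler_ln ?posrE ?expR_gt0 //; apply: ltW; apply: lt_trans N2 _.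
  by rewrite ltr_nat.
rewrite -[leRHS]expRK ler_ln ?posrE ?expR_gt0 //.
have pl : p%:R <= 64 * T * expR T.
  apply: le_trans (_ : (2 * (N.+1 * s))%:R <= _); first by rewrite ler_nat.
  have sT : s%:R <= 16 * T by rewrite /s natrD natrM -[j]addn1 natrD; lra.
  have NT : N.+1%:R <= 2 * expR T by rewrite -[N.+1]addn2 natrD; lra.
  rewrite !natrM; nra.
apply: le_trans pl _; have -> : (1 + e) * T = T + e * T by ring.
rewrite expRD mulrC ler_pM2l ?expR_gt0 //.
have := expR_ge1Dxn 1 (ltW (mulr_gt0 e0 T0)).
have : 256 <= T * e ^+ 2 by rewrite -ler_pdivrMr ?exprn_gt0.
rewrite -[2`!]/2%N exprMn => h1 h2; apply: le_trans h2.
have e20 : 0 < e ^+ 2 by rewrite exprn_gt0.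
nra.
Qed.

(** * The tower *)

(* [(D, A, B)] encodes the field generated by the real [D]-th root of [A / B]. *)
Definition stage : Type := (nat * nat * nat)%type.

Definition stage_rat (st : stage) : rat := st.1.2%:R / st.2%:R.

Definition stage_root (st : stage) : algC := st.1.1.-root (st.1.2%:R / st.2%:R).

Definition stage_field (st : stage) : set algC := Qadjoin (stage_root st).

(** The last clause is the criterion of [deg_radical]; B <= A and coprimality make ln A / D the
    height of the generator. *)
Definition good_stage (st : stage) : Prop :=
  [/\ (0 < st.1.1)%N, (0 < st.2)%N, (st.2 <= st.1.2)%N, coprime st.1.2 st.2 &
      forall (k : nat) (x : rat), 0 < x -> x ^+ st.1.1 = stage_rat st ^+ k -> (st.1.1 %| k)%N].

(** The new generator is the product of the D-th root of A / B and the l-th root of p / q. *)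
Definition next_stage (st c : stage) : stage :=
  ((st.1.1 * c.1.1)%N, (st.1.2 ^ c.1.1 * c.1.2 ^ st.1.1)%N, (st.2 ^ c.1.1 * c.2 ^ st.1.1)%N).

(* Here [c = (l, p, q)]. *)
Definition admissible (st c : stage) : Prop :=
  [/\ [/\ prime c.1.1, prime c.1.2 & prime c.2], (st.1.1 < c.1.1)%N, (c.2 < c.1.2)%N,
      (st.1.1 * c.1.1 < c.2)%N & (st.1.2 * st.2 < c.2)%N].

Lemma good_stage_one : good_stage (1%N, 1%N, 1%N).
Proof. by split=> //= k x _ _; apply: dvd1n. Qed.

Section Stage.
Variables (D A B : nat).
Local Notation st := (D, A, B).
Hypothesis gst : good_stage st.
Local Notation y := (stage_root st).

Lemma stage_rat_gt0 : 0 < stage_rat st.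
Proof.
case: gst => /= D0 B0 BA _ _; rewrite /stage_rat /= divr_gt0 ?ltr0n //.
exact: leq_trans BA.
Qed.

Lemma ratr_stage_rat : ratr (stage_rat st) = A%:R / B%:R :> algC.
Proof. by rewrite /stage_rat fmorph_div /= !ratr_nat. Qed.

Lemma stage_rootX : y ^+ D = A%:R / B%:R.
Proof. by case: gst => /= D0 *; rewrite /stage_root rootCK. Qed.

Lemma deg_stage_root : deg y = D.
Proof.
case: (gst) => /= D0 _ _ _ irr; apply: (deg_radical D0 stage_rat_gt0) => //.
by rewrite ratr_stage_rat stage_rootX.
Qed.

Lemma stage_root_gt0 : 0 < y.
Proof.
case: gst => /= D0 B0 BA _ _; rewrite /stage_root rootC_gt0 // divr_gt0 ?ltr0n //.
exact: leq_trans BA.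
Qed.

Lemma stage_root_gt1 : (B < A)%N -> 1 < y.
Proof.
case: gst => /= D0 B0 _ _ _ BA; have y0 := ltW stage_root_gt0.
rewrite -(@ltr_pXn2r _ D) ?nnegrE // expr1n stage_rootX ltr_pdivlMr ?ltr0n //.
by rewrite mul1r ltr_nat.
Qed.

Lemma height_stage_root (R : realType) : height R y = ln A%:R / D%:R.
Proof.
case: (gst) => /= D0 B0 BA cAB _.
by apply: (height_radical _ D0 B0) => //; [apply: stage_rootX | apply: deg_stage_root].
Qed.

Lemma deg_le_stage (a : algC) : stage_field st a -> (deg a <= D)%N.
Proof.
case: (gst) => /= D0 _ _ _ _ [P ->].
have nzr : ratr (stage_rat st) != 0 :> algC by rewrite fmorph_eq0 gt_eqF // stage_rat_gt0.
have yD : y ^+ D = ratr (stage_rat st) by rewrite ratr_stage_rat stage_rootX.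
have [s [us szs ms]] := exists_rootsC D0 nzr.
have [N _ ND] := prod_conj_exp D0 yD deg_stage_root us szs ms P.
by rewrite -[leqRHS]ND leq_pmull // lt0n; apply: contraTneq D0 => N0; rewrite -ND N0.
Qed.

End Stage.

Section NextStage.
Variables (D A B l p q : nat).
Local Notation st := (D, A, B).
Hypothesis gst : good_stage st.
Local Notation y := (stage_root st).
Local Notation c := (l, p, q).
Hypothesis adm : admissible st c.
Local Notation st' := (next_stage st c).
Local Notation y' := (stage_root st').
Local Notation x := (stage_root (l, p, q)).

Lemma stage_rat_next :
  stage_rat st' = stage_rat st ^+ l * (p%:R / q%:R) ^+ D.
Proof. by rewrite /stage_rat /= !natrM !natrX !exprMn !exprVn invfM mulrACA. Qed.

Lemma logn_new_prime (t : nat) : (A * B < t)%N -> prime t -> logn t A = 0%N /\ logn t B = 0%N.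
Proof.
case: gst => /= _ B0 BA _ _ ltt pr_t; have A0 : (0 < A)%N by apply: leq_trans BA.
have nd n : (0 < n)%N -> (n <= A * B)%N -> logn t n = 0%N.
  move=> n0 nAB; apply/eqP; rewrite lognE pr_t n0 /= gtnNdvd //.
  exact: leq_ltn_trans nAB ltt.
by split; apply: nd; rewrite ?leq_pmulr ?leq_pmull.
Qed.

(** As p and q exceed A B, they occur only in (p / q)^D. The factors 1 and -1 are the u and v of the
    discriminant bound. *)
Lemma pval_stage_next :
  pval p (stage_rat st') = D%:Z * 1 /\ pval q (stage_rat st') = D%:Z * -1.
Proof.
case: (gst) (adm) => /= D0 B0 BA _ _ [[/= pr_l pr_p pr_q] _ qp _ ABq].
have A0 : (0 < A)%N by apply: leq_trans BA.
have nz n : (0 < n)%N -> n%:R != 0 :> rat by rewrite pnatr_eq0 -lt0n.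
have nzst : stage_rat st != 0 by rewrite gt_eqF // (stage_rat_gt0 gst).
have nzpq : p%:R / q%:R != 0 :> rat by rewrite mulf_neq0 ?invr_eq0 ?nz ?prime_gt0.
have val t : (A * B < t)%N -> prime t -> pval t (stage_rat st') = pval t (p%:R / q%:R) * D%:Z.
  move=> ltt pr_t; have [lA lB] := logn_new_prime ltt pr_t.
  rewrite stage_rat_next pvalM ?expf_neq0 // !pvalX // {1}/stage_rat /= pvalM ?invr_eq0 ?nz //.
  by rewrite pvalV ?nz // !pval_nat lA lB oppr0 addr0 mul0r add0r.
rewrite !val // ?(ltn_trans ABq) // !pvalM ?invr_eq0 ?nz ?prime_gt0 // !pvalV ?nz ?prime_gt0 // !pval_nat.
rewrite !logn_prime // !eqxx (gtn_eqF qp) (ltn_eqF qp).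
by rewrite /= subr0 sub0r mul1r mulr1 mulrN1 mulN1r.
Qed.

Lemma coprime_stage : coprime l D.
Proof.
case: (gst) (adm) => /= D0 _ _ _ _ [[/= pr_l _ _] Dl _ _ _].
by rewrite prime_coprime // gtnNdvd.
Qed.

Lemma good_next_stage : good_stage st'.
Proof.
case: (gst) (adm) => /= D0 B0 BA cAB irr [[/= pr_l pr_p pr_q] Dl qp Dlq ABq].
have A0 : (0 < A)%N by apply: leq_trans BA.
have l0 := prime_gt0 pr_l; have p0 := prime_gt0 pr_p; have q0 := prime_gt0 pr_q.
split=> /=; first by rewrite muln_gt0 D0.
- by rewrite muln_gt0 !expn_gt0 B0 q0.
- by apply: leq_mul; rewrite leq_exp2r // ltnW.
- have nd t n : prime t -> (A * B < t)%N -> (0 < n)%N -> (n <= A * B)%N -> coprime t n.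
    move=> pr_t ltt n0 nAB; rewrite prime_coprime // gtnNdvd //; exact: leq_ltn_trans nAB ltt.
  rewrite coprimeMl !coprimeMr !coprimeXl ?coprimeXr //=.
  + by rewrite prime_coprime // dvdn_prime2 // gtn_eqF.
  + by apply: nd; rewrite ?leq_pmull // (ltn_trans ABq).
  + by rewrite coprime_sym; apply: nd; rewrite ?leq_pmulr.
move=> k t t0 E0; have E : t ^+ (D * l) = stage_rat st' ^+ k := E0.
have nzst : stage_rat st != 0 by rewrite gt_eqF // (stage_rat_gt0 gst).
have st0 := stage_rat_gt0 gst.
have pq0 : 0 < p%:R / q%:R :> rat by rewrite divr_gt0 ?ltr0n.
(* Valuations at p of both sides give D l v(t) = D k. *)
have lk : (l %| k)%N.
  have [vp _] := pval_stage_next.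
  have nzst' : stage_rat st' != 0.
    by rewrite stage_rat_next gt_eqF // mulr_gt0 ?exprn_gt0.
  have nzt : t != 0 by rewrite gt_eqF.
  have := congr1 (pval p) E; rewrite (pvalX _ _ nzt) (pvalX _ _ nzst') vp mulr1 PoszM => /eqP.
  rewrite mulrC -mulrA (inj_eq (mulfI _)) ?eqz_nat -?lt0n // => /eqP /(congr1 absz).
  by rewrite abszM /= => <-; apply: dvdn_mulr.
(* With k = k' l, dividing t by (p / q)^k' and taking positive l-th roots leaves a D-th power equal
   to (A / B)^k. *)
have Dk : (D %| k)%N.
  move: lk => /dvdnP[k' Dk']; apply: (irr k (t / (p%:R / q%:R) ^+ k')).
    by rewrite divr_gt0 ?exprn_gt0.
  apply: (@pexpIrn _ l) => //; rewrite ?nnegrE ?exprn_ge0 ?divr_ge0 ?exprn_ge0 ?(ltW t0) ?(ltW pq0) ?(ltW st0) //.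
  rewrite -[LHS]exprM exprMn E stage_rat_next exprMn exprVn -!exprM Dk'.
  have -> : (k' * (D * l) = D * (k' * l))%N by ring.
  rewrite mulfK ?expf_neq0 ?gt_eqF // -?exprM //; congr (_ ^+ _); ring.
by rewrite Gauss_dvd ?Dk ?lk // coprime_sym coprime_stage.
Qed.

Lemma stage_root_next : y' = y * x.
Proof.
case: (gst) (adm) => /= D0 B0 BA _ _ [[/= pr_l pr_p pr_q] _ _ _ _].
have l0 := prime_gt0 pr_l; have p0 := prime_gt0 pr_p; have q0 := prime_gt0 pr_q.
have Dl0 : (0 < D * l)%N by rewrite muln_gt0 D0.
have x0 : 0 < x by rewrite /stage_root /= rootC_gt0 // divr_gt0 ?ltr0n.
have y0 := stage_root_gt0 gst.
have A0 : (0 < A)%N by apply: leq_trans BA.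
apply: (@pexpIrn _ (D * l)) => //; rewrite ?nnegrE ?mulr_ge0 ?(ltW x0) ?(ltW y0) //.
  by rewrite /stage_root /= rootC_ge0 // divr_ge0.
rewrite /= {1}/stage_root /= rootCK // exprMn [in y ^+ _]exprM (stage_rootX gst).
rewrite [in x ^+ _]mulnC exprM /stage_root /= rootCK // !natrM !natrX !exprMn !exprVn invfM.
by rewrite mulrACA.
Qed.


Lemma stage_field_next : stage_field st `<=` stage_field st'.
Proof.
case: (gst) (adm) => /= D0 B0 BA _ _ [[/= pr_l pr_p pr_q] _ _ _ _].
have l0 := prime_gt0 pr_l; have fL := Qadjoin_subfield y'.
have y0 := stage_root_gt0 gst.
have Lr (n m : nat) : stage_field st' (n%:R / m%:R).
  by have := subfield_rat fL (n%:R / m%:R); rewrite fmorph_div /= !ratr_nat.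
have Ly' : stage_field st' y' by exists 'X; rewrite evalQX.
have xl : x ^+ l = p%:R / q%:R by rewrite /stage_root /= rootCK.
have nzpq : p%:R / q%:R != 0 :> algC.
  by rewrite mulf_neq0 ?invr_eq0 ?pnatr_eq0 -?lt0n ?prime_gt0.
have Lyl : stage_field st' (y ^+ l).
  have -> : y ^+ l = y' ^+ l / (p%:R / q%:R) by rewrite stage_root_next exprMn xl mulfK.
  by apply: (subfield_div fL); [apply: (subfieldX fL) | apply: Lr].
have Ly : stage_field st' y.
  (* From u l = v D + 1, y is recovered from y^l and the rational number y^D. *)
  case: (egcdnP D l0) => u v E _; rewrite (eqP coprime_stage) in E.
  have -> : y = (y ^+ l) ^+ u / (y ^+ D) ^+ v.
    rewrite -!exprM mulnC E exprD expr1 mulnC mulrAC divff ?mul1r //.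
    by rewrite expf_neq0 // gt_eqF.
  apply: (subfield_div fL); first exact: (subfieldX fL).
  by apply: (subfieldX fL); rewrite (stage_rootX gst); apply: Lr.
by move=> a [P ->]; apply: (subfield_evalQ fL).
Qed.

Lemma step_radical_in_next : stage_field st' x.
Proof.
have fL := Qadjoin_subfield y'; have y0 := stage_root_gt0 gst.
have -> : x = y' / y by rewrite stage_root_next mulrC mulKf // gt_eqF.
apply: (subfield_div fL); first by exists 'X; rewrite evalQX.
by apply: stage_field_next; exists 'X; rewrite evalQX.
Qed.

Lemma next_root_exp_field : Qadjoin (y' ^+ l) `<=` stage_field st.
Proof.
case: (adm) => [[/= pr_l _ _] _ _ _ _]; have l0 := prime_gt0 pr_l.
have fL := Qadjoin_subfield y.
move=> a [P ->]; apply: (subfield_evalQ fL).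
have -> : y' ^+ l = y ^+ l * ratr (p%:R / q%:R).
  by rewrite stage_root_next exprMn /stage_root /= rootCK // fmorph_div /= !ratr_nat.
apply: (subfieldM fL); last exact: subfield_rat fL _.
by apply: (subfieldX fL); exists 'X; rewrite evalQX.
Qed.

Section NewElement.
Variable a : algC.
Hypotheses (aN : stage_field st' a) (aO : ~ stage_field st a).

Let notin_exp : ~ Qadjoin (y' ^+ l) a. Proof. by move=> /next_root_exp_field. Qed.

Let y'D : y' ^+ (D * l) = ratr (stage_rat st').
Proof.
by rewrite ratr_stage_rat (stage_rootX good_next_stage).
Qed.

Lemma deg_new_ge : (l <= deg a)%N.
Proof.
case: (gst) (adm) => /= D0 _ _ _ _ [[/= pr_l _ _] _ _ _ _].
apply: (deg_ge_radical pr_l D0 _ y'D (deg_stage_root good_next_stage) aN notin_exp).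
by rewrite gt_eqF // (stage_rat_gt0 good_next_stage).
Qed.

Lemma height_new_ge (R : realType) :
  (ln p%:R + ln q%:R) / (2 * l%:R) - ln l%:R / l%:R <= height R a.
Proof.
case: (gst) (adm) => /= D0 _ _ _ _ [[/= pr_l pr_p pr_q] _ qp Dlq _].
have nz : stage_rat st' != 0 by rewrite gt_eqF // (stage_rat_gt0 good_next_stage).
have [vp vq] := pval_stage_next.
apply: (height_radical_ge R pr_l D0 nz y'D (deg_stage_root good_next_stage) aN notin_exp
  pr_p pr_q _ _ Dlq vp vq).
- by rewrite gtn_eqF.
- exact: ltn_trans qp.
- by rewrite absz1 dvdn1 gtn_eqF // prime_gt1.
- by rewrite abszN absz1 dvdn1 gtn_eqF // prime_gt1.
Qed.

End NewElement.

End NextStage.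

(** (l, p, q) is the successor of the trivial stage (1, 1, 1), so the results on stages also apply
    to the radical x. *)
Lemma good_radical (l p q : nat) : prime l -> prime p -> prime q -> (q < p)%N -> (l < q)%N ->
  good_stage (l, p, q).
Proof.
move=> pr_l pr_p pr_q qp lq.
have := good_next_stage good_stage_one (l := l) (p := p) (q := q).
rewrite /next_stage /= mul1n !exp1n !mul1n !expn1; apply; split=> //=.
- exact: prime_gt1.
- by rewrite mul1n.
- by rewrite muln1 prime_gt1.
Qed.

(** The height of the new generator is the sum of the heights of the old one and of the new
    radical. *)
Lemma height_next (R : realType) (D A l p : nat) : (0 < D)%N -> (0 < l)%N -> (0 < A)%N -> (0 < p)%N ->
  ln ((A ^ l * p ^ D)%:R : R) / (D * l)%:R = ln A%:R / D%:R + ln p%:R / l%:R.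
Proof.
move=> D0 l0 A0 p0; rewrite !natrM !natrX lnM ?posrE ?exprn_gt0 ?ltr0n // !lnXn ?ltr0n //.
rewrite -(mulr_natr (ln A%:R)) -(mulr_natr (ln p%:R)); field.
by rewrite !pnatr_eq0 -!lt0n D0 l0.
Qed.

(** * Choice of the parameters *)

Section Asymptotics.
Variable R : realType.
Implicit Types (g d e K x : R) (n : nat).

Lemma powR_nat n x : (0 < n)%N -> n%:R `^ x = expR (x * ln n%:R) :> R.
Proof. by move=> n0; rewrite /powR pnatr_eq0 gtn_eqF. Qed.

Lemma powR_nat_gt0 n x : (0 < n)%N -> 0 < n%:R `^ x :> R.
Proof. by move=> n0; rewrite powR_gt0 // ltr0n. Qed.

Lemma powR_natD n x d : (0 < n)%N -> n%:R `^ (x + d) = n%:R `^ x * n%:R `^ d :> R.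
Proof. by move=> n0; rewrite !powR_nat // mulrDl expRD. Qed.

Lemma ler_powR_nat m n x : (0 < m)%N -> (m <= n)%N -> 0 <= x -> m%:R `^ x <= n%:R `^ x :> R.
Proof.
move=> m0 mn x0; have n0 := leq_trans m0 mn.
by rewrite !powR_nat // ler_expR ler_wpM2l // ler_ln ?posrE ?ltr0n // ler_nat.
Qed.

Lemma ler_powR_nat_neg m n x : (0 < m)%N -> (m <= n)%N -> x <= 0 -> n%:R `^ x <= m%:R `^ x :> R.
Proof.
move=> m0 mn x0; have n0 := leq_trans m0 mn.
by rewrite !powR_nat // ler_expR ler_wnM2l // ler_ln ?posrE ?ltr0n // ler_nat.
Qed.

Lemma near_powR_ge d K : 0 < d -> \forall n \near \oo, K <= n%:R `^ d.
Proof.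
move=> d0; exists (Num.Def.trunc (expR (K / d))).+1 => // n /= leN.
have n0 : (0 < n)%N by apply: leq_trans leN.
have /andP[_ h] := truncn_itv (expR_ge0 (K / d)).
have : expR (K / d) <= n%:R by apply: ltW; apply: lt_le_trans h _; rewrite ler_nat.
rewrite -ler_ln ?posrE ?expR_gt0 ?ltr0n // expRK ler_pdivrMr // mulrC => h1.
rewrite powR_nat //; apply: le_trans h1 _; apply: le_trans (expR_ge1Dx _).
by rewrite lerDr.
Qed.

Lemma near_ln_le d e : 0 < d -> 0 < e -> \forall n \near \oo, ln n%:R <= e * n%:R `^ d.
Proof.
move=> d0 e0; have d20 : 0 < d / 2 by rewrite divr_gt0.
near=> n; have n0 : (0 < n)%N by near: n; exists 1%N.
have : (e * (d / 2))^-1 <= n%:R `^ (d / 2) by near: n; apply: near_powR_ge.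
set X := n%:R `^ (d / 2) => h; have X0 : 0 < X by apply: powR_nat_gt0.
have -> : n%:R `^ d = X * X by rewrite -powR_natD // -splitr.
have h1 : (d / 2) * ln n%:R <= X.
  by rewrite /X powR_nat //; apply: le_trans (expR_ge1Dx _); rewrite lerDr.
have h2 : 1 <= X * (e * (d / 2)).
  by rewrite -ler_pdivrMr ?mulr_gt0 // mul1r.
rewrite -(ler_pM2l d20); apply: le_trans h1 _.
rewrite -[leLHS]mulr1; apply: le_trans (_ : X * (X * (e * (d / 2))) <= _).
  by rewrite ler_pM2l.
by rewrite le_eqVlt; apply/orP; left; apply/eqP; ring.
Unshelve. all: by end_near. Qed.

End Asymptotics.

(* In the next stage, the elements of smallest [gamma]-weighted height have the smallest possible
   degree [l] when [gamma >= 0] and the largest possible degree [D * l] when [gamma < 0]. *)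
Definition extremal_deg (R : realType) (gamma : R) (D l : nat) : nat :=
  if 0 <= gamma then l else (D * l)%N.

(** The part of the height of the test element inherited from the previous stage: none for the
    radical x, the height of y for the generator y x. *)
Definition carried_height (R : realType) (gamma : R) (D A : nat) : R :=
  if 0 <= gamma then 0 else ln A%:R / D%:R.

(** Not Karamata's condition: every power n^d with d > 0 dominates both phi and 1 / phi. *)
Definition slowly_varying (R : realType) (phi : nat -> R) : Prop :=
  forall d : R, 0 < d ->
    (forall K, \forall n \near \oo, K <= phi n * n%:R `^ d) /\
    (forall e, 0 < e -> \forall n \near \oo, phi n <= e * n%:R `^ d).

(** The lower estimate serves all new elements, the upper one the test element. Of the 2 e, one e
    pays for ln p <= (1 + e) T and the other for the carried height. *)
Definition well_chosen (R : realType) (gamma : R) (phi : nat -> R) (e : R) (st c : stage) : Prop :=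
  let W : R := (extremal_deg gamma st.1.1 c.1.1)%:R `^ gamma in
  (1 - e) * phi c.1.1 <=
    W * ((ln c.1.2%:R + ln c.2%:R) / (2 * c.1.1%:R) - ln c.1.1%:R / c.1.1%:R) /\
  W * (carried_height gamma st.1.1 st.1.2 + ln c.1.2%:R / c.1.1%:R) <= (1 + 2 * e) * phi c.1.1.

Lemma exists_well_chosen (R : realType) (gamma : R) (phi : nat -> R) (e : R) (n : nat) (st : stage) :
  gamma < 1 -> slowly_varying phi -> 0 < e -> good_stage st ->
  exists c, [/\ admissible st c, (n < c.1.1)%N & well_chosen gamma phi e st c].
Proof.
case: st => [[D A] B] g1 sv e0 gst; case: (gst) => /= D0 B0 BA _ _.
have A0 : (0 < A)%N by apply: leq_trans BA.
(* Half of the available exponent: one factor l^d makes up for phi(l), which may tend to 0, and the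
   other remains in T >= l^d. *)
pose d := (1 - gamma) / 2; have d0 : 0 < d by rewrite divr_gt0 // subr_gt0.
have dE : 1 - gamma = d + d by rewrite /d -splitr.
have [T0 HT0] := exists_two_primes e0.
(* The carried height is fixed before l is chosen. For gamma < 0 its weight is at most l^gamma, so a
   large l makes it contribute at most e phi(l). *)
have Hg : \forall l \near \oo, gamma < 0 -> ln A%:R / D%:R / e <= phi l * l%:R `^ (- gamma).
  have [gneg|gpos] := ltP gamma 0; last by exists 0%N => // l _; rewrite ltNge gpos.
  have ng : 0 < - gamma by rewrite oppr_gt0.
  by apply: filterS ((sv _ ng).1 (ln A%:R / D%:R / e)) => l h _.
have : \forall l \near \oo, [/\ 1 <= phi l * l%:R `^ d,
   [/\ T0 <= l%:R `^ d, 2 * ln D%:R + 1 <= l%:R `^ d & ln (A * B)%:R + 1 <= l%:R `^ d],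
   ln l%:R <= Num.min e (1 / 2) * l%:R `^ d,
   (maxn n D < l)%N & gamma < 0 -> ln A%:R / D%:R / e <= phi l * l%:R `^ (- gamma)].
  near=> l; split.
  - by near: l; apply: (sv d d0).1.
  - by split; near: l; apply: near_powR_ge.
  - by near: l; apply: near_ln_le => //; rewrite lt_min e0 divr_gt0.
  - by near: l; exists (maxn n D).+1.
  - by near: l.
move=> [N _ HN]; have [l lN pr_l] := prime_above N.
have [Hphi [X1 X2 X3] Hln nDl Hneg] := HN l (ltnW lN).
have l0 := prime_gt0 pr_l; have lR : 0 < l%:R :> R by rewrite ltr0n.
move: nDl; rewrite gtn_max => /andP[nl Dl].
set X := l%:R `^ d in Hphi X1 X2 X3 Hln; have X0 : 0 < X by apply: powR_nat_gt0.
have phi0 : 0 < phi l by rewrite -(pmulr_lgt0 _ X0); apply: lt_le_trans Hphi.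
pose w := extremal_deg gamma D l.
have w0 : (0 < w)%N by rewrite /w /extremal_deg; case: ifP => // _; rewrite muln_gt0 D0.
pose W : R := w%:R `^ gamma; have W0 : 0 < W by apply: powR_nat_gt0.
have Wl : W <= l%:R `^ gamma.
  rewrite /W /w /extremal_deg; case: (leP 0 gamma) => // gneg.
  by apply: ler_powR_nat_neg; rewrite ?leq_pmull // ltW.
(* T solves W T / l = phi(l), the target for the weighted height. *)
pose T := phi l * l%:R / W.
have TX : X <= T.
  have lg0 : 0 < l%:R `^ gamma :> R by apply: powR_nat_gt0.
  rewrite /T ler_pdivlMr //; apply: le_trans (_ : X * l%:R `^ gamma <= _).
    by rewrite ler_pM2l.
  have lE : X * X * l%:R `^ gamma = l%:R.
    by rewrite -!powR_natD // -dE subrK powRr1.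
  have -> : phi l * l%:R = phi l * X * X * l%:R `^ gamma by rewrite -!mulrA [X * (X * _)]mulrA lE.
  by rewrite ler_pM2r // -[leLHS]mul1r ler_pM2r.
have T_gt0 : 0 < T by apply: lt_le_trans TX.
have [p [q [pr_p pr_q qp Tq pT]]] := HT0 T (le_trans X1 TX).
have p0 : 0 < p%:R :> R by rewrite ltr0n prime_gt0.
have q0 : 0 < q%:R :> R by rewrite ltr0n prime_gt0.
have Tp : T <= ln p%:R.
  by apply: le_trans Tq _; rewrite ler_ln ?posrE // ler_nat ltnW.
have gt_q m : (0 < m)%N -> ln m%:R < T -> (m < q)%N.
  move=> m_gt0 mT; have mq : ln m%:R < ln q%:R :> R by exact: lt_le_trans mT Tq.
  by rewrite -(ltr_nat R) -ltr_ln ?posrE ?q0 ?ltr0n.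
(* The bound ln l <= e T keeps the error of the height bound within e phi(l); the bound ln l <= T /
   2, with 2 ln D + 1 <= T, yields D l < q. *)
set k := Num.min e (1 / 2) in Hln.
have m0 : 0 < k by rewrite lt_min e0 divr_gt0.
have me : k <= e by rewrite ge_min lexx.
have m2 : k <= 1 / 2 by rewrite ge_min lexx orbT.
have lnl1 := le_trans Hln (ler_pM (ltW m0) (ltW X0) me TX).
have lnl2 := le_trans Hln (ler_pM (ltW m0) (ltW X0) m2 TX).
exists (l, p, q); split => //=.
  split=> //=.
  - apply: gt_q; first by rewrite muln_gt0 D0.
    rewrite natrM lnM ?posrE ?ltr0n //; lra.
  - apply: gt_q; first by rewrite muln_gt0 A0.
    lra.
have WT : W * (T / l%:R) = phi l.
  by rewrite /T; field; rewrite !gt_eqF.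
rewrite /well_chosen /= -/w -/W; split.
  have -> : (1 - e) * phi l = W * ((1 - e) * T / l%:R) by rewrite -WT; ring.
  rewrite ler_pM2l //.
  have -> : (ln p%:R + ln q%:R) / (2 * l%:R) - ln l%:R / l%:R = ((ln p%:R + ln q%:R) / 2 - ln l%:R) / l%:R :> R.
    by field; rewrite gt_eqF.
  rewrite ler_pM2r ?invr_gt0 //; lra.
have hp : W * (ln p%:R / l%:R) <= (1 + e) * phi l.
  have -> : (1 + e) * phi l = W * ((1 + e) * T / l%:R) by rewrite -WT; ring.
  by rewrite ler_pM2l // ler_pM2r ?invr_gt0.
have hc : W * carried_height gamma D A <= e * phi l.
  rewrite /carried_height; move: Hneg; case: (leP 0 gamma) => [_ _|gneg /(_ isT)]; first by rewrite mulr0 mulr_ge0 ?ltW.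
  rewrite ler_pdivrMr // => h.
  apply: le_trans (_ : W * (phi l * l%:R `^ (- gamma) * e) <= _); first by rewrite ler_pM2l.
  have lg : l%:R `^ gamma * l%:R `^ (- gamma) = 1 :> R by rewrite -powR_natD // subrr powRr0.
  have : W * l%:R `^ (- gamma) <= 1.
    by have := ler_wpM2r (ltW (powR_nat_gt0 (- gamma) l0)) Wl; rewrite lg.
  have : 0 < e * phi l by rewrite mulr_gt0.
  nra.
rewrite mulrDr; lra.
Unshelve. all: by end_near. Qed.

(** * Weighted heights in the tower *)

Lemma near_natSinv_le (R : realType) (e : R) : 0 < e -> \forall n \near \oo, n.+1%:R^-1 <= e.
Proof.
by move=> e0; apply: filterS (near_infty_natSinv_lt (PosNum e0)) => n /ltW.
Qed.

(** The test element [t n] is real and greater than 1, hence not a root of unity; its degree is at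
    least l n > n, so the test elements form an infinite set. *)
Record weighted_tower (R : realType) (gamma : R) (phi : nat -> R)
    (F : nat -> set algC) (l : nat -> nat) (t : nat -> algC) : Prop := WeightedTower {
  tower_subfield : forall n, subfield (F n);
  tower_incl : forall n, F n `<=` F n.+1;
  tower_deg : forall n, exists D : nat, forall a, F n a -> (deg a <= D)%N;
  tower_gt : forall n, (n < l n)%N;
  tower_test : forall n, [/\ F n.+1 (t n), 1 < t n, (l n <= deg (t n))%N
    & wheight gamma (t n) <= (1 + 2 * n.+1%:R^-1) * phi (l n)];
  tower_new : forall n a, F n.+1 a -> ~ F n a ->
    (l n <= deg a)%N /\ (1 - n.+1%:R^-1) * phi (l n) <= wheight gamma a }.

Lemma exists_stages (R : realType) (gamma : R) (phi : nat -> R) :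
  gamma < 1 -> slowly_varying phi ->
  exists st c : nat -> stage, forall n,
    [/\ good_stage (st n), admissible (st n) (c n), st n.+1 = next_stage (st n) (c n),
        (n < (c n).1.1)%N & well_chosen gamma phi n.+1%:R^-1 (st n) (c n)].
Proof.
move=> g1 sv.
have /choice[f Hf] : forall x : nat * stage, exists c, good_stage x.2 ->
    [/\ admissible x.2 c, (x.1 < c.1.1)%N & well_chosen gamma phi x.1.+1%:R^-1 x.2 c].
  move=> [n st] /=; have [gst|ngst] := pselect (good_stage st); last by exists st.
  have e0 : 0 < n.+1%:R^-1 :> R by rewrite invr_gt0 ltr0n.
  by have [c Hc] := exists_well_chosen n g1 sv e0 gst; exists c.
pose fix st n : stage := if n is m.+1 then next_stage (st m) (f (m, st m)) else (1%N, 1%N, 1%N).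
pose c n := f (n, st n).
have good n : good_stage (st n).
  elim: n => [|n IHn]; first exact: good_stage_one.
  have [] := Hf (n, st n) IHn => /=.
  case: (st n) IHn => [[D A] B] gst; case: (f _) => [[l p] q] adm _ _.
  exact: good_next_stage.
by exists st, c => n; have [] := Hf (n, st n) (good n).
Qed.

Lemma wheight_ge (R : realType) (gamma b : R) (a : algC) (w : nat) :
  w%:R `^ gamma <= (deg a)%:R `^ gamma -> b <= height R a ->
  w%:R `^ gamma * b <= wheight gamma a.
Proof.
move=> wd ba; apply: le_trans (_ : w%:R `^ gamma * height R a <= _).
  by rewrite ler_wpM2l // powR_ge0.
by rewrite /wheight ler_wpM2r // height_ge0.
Qed.

Lemma exists_weighted_tower (R : realType) (gamma : R) (phi : nat -> R) :
  gamma < 1 -> slowly_varying phi ->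
  exists (F : nat -> set algC) (l : nat -> nat) (t : nat -> algC), weighted_tower gamma phi F l t.
Proof.
move=> g1 sv; have [st [c H]] := exists_stages g1 sv.
exists (fun n => stage_field (st n)), (fun n => (c n).1.1),
  (fun n => stage_root (if 0 <= gamma then c n else st n.+1)).
split=> n /=.
- exact: Qadjoin_subfield.
- have [gst adm -> _ _] := H n.
  case: (st n) gst adm => [[D A] B] gst; case: (c n) => [[l p] q] adm.
  exact: stage_field_next.
- have [gst _ _ _ _] := H n; exists (st n).1.1 => a.
  by case: (st n) gst => [[D A] B] gst; apply: deg_le_stage.
- by have [] := H n.
- have [gst adm E _ [_ wc]] := H n; rewrite E.
  case: (st n) gst adm wc => [[D A] B] gst; case: (c n) => [[l p] q] adm wc.
  case: (gst) (adm) => /= D0 B0 BA _ _ [/= [pr_l pr_p pr_q] Dl qp Dlq ABq].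
  have A0 : (0 < A)%N by apply: leq_trans BA.
  have lq : (l < q)%N by apply: leq_ltn_trans Dlq; rewrite leq_pmull.
  have gc := good_radical pr_l pr_p pr_q qp lq.
  have gn := good_next_stage gst adm.
  have BA' : (B ^ l * q ^ D < A ^ l * p ^ D)%N.
    apply: leq_ltn_trans (_ : A ^ l * q ^ D < _)%N.
      by rewrite leq_mul2r leq_exp2r ?BA ?orbT // prime_gt0.
    by rewrite ltn_pmul2l ?expn_gt0 ?A0 // ltn_exp2r.
  move: wc; rewrite /extremal_deg /carried_height /=; case: (leP 0 gamma) => gs wc.
    split; first exact: step_radical_in_next.
    + exact: stage_root_gt1.
    + by rewrite (deg_stage_root gc).
    + by rewrite /wheight (deg_stage_root gc) (height_stage_root gc) -[X in _ * X]add0r.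
  split; first by exists 'X; rewrite evalQX.
  + exact: (stage_root_gt1 gn).
  + by rewrite (deg_stage_root gn) leq_pmull.
  + by rewrite /wheight (deg_stage_root gn) (height_stage_root gn) height_next // prime_gt0.
- move=> a; have [gst adm -> _ [wc _]] := H n.
  case: (st n) gst adm wc => [[D A] B] gst; case: (c n) => [[l p] q] adm /= wc aN aO.
  have la := deg_new_ge gst adm aN aO; split=> //; apply: le_trans wc _.
  have l0 : (0 < l)%N by case: adm => [[/= /prime_gt0]].
  apply: wheight_ge; last exact: (height_new_ge gst adm aN aO).
  rewrite /extremal_deg; case: (leP 0 gamma) => gs; first exact: ler_powR_nat.
  apply: ler_powR_nat_neg; rewrite ?deg_gt0 ?(ltW gs) //.
  by have := deg_le_stage (good_next_stage gst adm) aN.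
Qed.

(** * Northcott and Bogomolov properties of the union *)

Section TowerUnion.
Variables (R : realType) (gamma : R) (phi : nat -> R).
Variables (F : nat -> set algC) (l : nat -> nat) (t : nat -> algC).
Hypothesis tw : weighted_tower gamma phi F l t.
Let L : set algC := [set a | exists n, F n a].

Lemma tower_incl_le (m n : nat) : (m <= n)%N -> F m `<=` F n.
Proof.
move=> /subnK<-; elim: (n - m)%N => // k IHk a /IHk; exact: (tower_incl tw).
Qed.

Lemma tower_union_subfield : subfield L.
Proof.
split; first by rewrite inE; exists 0%N; apply: (subfield1 (tower_subfield tw 0)).
- move=> a b; rewrite !inE => -[m Fa] [n Fb]; exists (maxn m n).
  apply: (subfieldB (tower_subfield tw _)).
    exact: (tower_incl_le (leq_maxl m n)).
  exact: (tower_incl_le (leq_maxr m n)).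
- move=> a b; rewrite !inE => -[m Fa] [n Fb]; exists (maxn m n).
  apply: (subfield_div (tower_subfield tw _)).
    exact: (tower_incl_le (leq_maxl m n)).
  exact: (tower_incl_le (leq_maxr m n)).
Qed.

Lemma tower_first (N : nat) (a : algC) : L a ->
  F N a \/ exists n, [/\ (N <= n)%N, F n.+1 a & ~ F n a].
Proof.
move=> [m Fm]; have [mN|Nm] := leqP m N; first by left; apply: (tower_incl_le mN).
move: Fm; rewrite -(subnK (ltnW Nm)); elim: (m - N)%N => [|k IHk]; first by left.
rewrite addSn => Fa; have [Fk|nFk] := pselect (F (k + N) a); first exact: IHk.
by right; exists (k + N)%N; rewrite leq_addl.
Qed.

Lemma wheightE (g : R) (a : algC) :
  wheight g a = (deg a)%:R `^ (g - gamma) * wheight gamma a.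
Proof. by rewrite /wheight mulrA -powR_natD ?deg_gt0 // subrK. Qed.

(** Elements of weighted height below C all lie in one fixed F N, where the degree and hence the
    height is bounded, and Northcott's theorem applies. *)
Lemma finite_small_height (g C : R) :
  (\forall n \near \oo, forall a, F n.+1 a -> ~ F n a -> C <= wheight g a) ->
  finite_set (small_height g L C).
Proof.
move=> [N _ HN]; have [D HD] := tower_deg tw N.
(* The height is the weighted height times deg(a)^(-g), a factor at most D^(-g) if g <= 0 and at
   most 1 otherwise; the sum covers both cases. *)
apply: (sub_finite_set _ (finite_bounded_height D (`|C| * (1 + D%:R `^ (- g))))) => a [La aC] /=.
have [Fa|[n [Nn Fa nFa]]] := tower_first N La; last by move: (HN n Nn a Fa nFa); rewrite leNgt aC.
split; first exact: HD.
have d0 := deg_gt0 a; have D0 : (0 < D)%N by apply: leq_trans (HD a Fa).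
have -> : height R a = wheight g a * (deg a)%:R `^ (- g).
  by rewrite /wheight mulrC mulrA -powR_natD // addNr powRr0 mul1r.
apply: ler_pM; rewrite ?powR_ge0 //.
- by rewrite mulr_ge0 ?powR_ge0 ?height_ge0.
- exact: le_trans (ltW aC) (ler_norm C).
have [gs|gs] := leP 0 (- g).
  by apply: le_trans (ler_powR_nat d0 (HD a Fa) gs) _; rewrite lerDr.
apply: le_trans (_ : 1%:R `^ (- g) <= _); first by apply: ler_powR_nat_neg => //; apply: ltW.
by rewrite powR1 lerDl powR_ge0.
Qed.

(** The test elements have unbounded degree, so no finite set contains all those of large index, and
    none of them is a root of unity. *)
Lemma infinite_small_height (g C : R) :
  (\forall n \near \oo, wheight g (t n) < C) ->
  infinite_set (small_height g (L `\` roots_of_unity L) C).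
Proof.
move=> [N _ HN] /finite_seqP[s Es].
pose M := \max_(a <- s) deg a; pose n := maxn N M.
have [Ft t1 lt _] := tower_test tw n.
have : small_height g (L `\` roots_of_unity L) C (t n).
  split; last by apply: HN; rewrite /= leq_maxl.
  split; first by exists n.+1.
  move=> [_ [k k0 /unity_rootP tk]]; have := exprn_egt1 k t1.
  by rewrite -lt0n k0 tk ltxx.
rewrite Es /= => ts.
have : (deg (t n) <= M)%N by apply: leq_bigmax_seq.
rewrite leqNgt; apply/negP; rewrite negbK.
apply: leq_trans (leq_trans (tower_gt tw n) lt).
by rewrite ltnS leq_maxr.
Qed.

Lemma near_tower_l (P : nat -> Prop) :
  (\forall n \near \oo, P n) -> \forall n \near \oo, P (l n).
Proof.
move=> [N _ HN]; exists N => // n /= Nn; apply: HN => /=.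
exact: leq_trans Nn (ltnW (tower_gt tw n)).
Qed.

Hypothesis sv : slowly_varying phi.

Lemma near_wheight_new (e : R) : 0 < e ->
  \forall n \near \oo, 0 <= phi (l n) /\ forall a, F n.+1 a -> ~ F n a ->
    (l n <= deg a)%N /\ (1 - e) * phi (l n) <= wheight gamma a.
Proof.
move=> e0; near=> n.
(* Only the sign of phi(l n) is wanted; any positive exponent would do. *)
have phi1 : 1 <= phi (l n) * (l n)%:R `^ 1.
  by near: n; apply: (@near_tower_l (fun k => 1 <= phi k * k%:R `^ 1)); apply: (sv ltr01).1.
have l0 : (0 < l n)%N by apply: leq_ltn_trans (tower_gt tw n).
have phi0 : 0 <= phi (l n).
  by rewrite -(pmulr_lge0 _ (powR_nat_gt0 1 l0)); apply: le_trans phi1.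
split=> // a Fa nFa; have [la wa] := tower_new tw Fa nFa.
split=> //; apply: le_trans wa; apply: ler_wpM2r => //; rewrite lerD2l lerN2.
by near: n; apply: near_natSinv_le.
Unshelve. all: by end_near. Qed.

Lemma near_wheight_test (e : R) : 0 < e ->
  \forall n \near \oo, wheight gamma (t n) <= (1 + e) * phi (l n).
Proof.
move=> e0; near=> n; have [_ _ _ wt] := tower_test tw n.
have phi1 : 1 <= phi (l n) * (l n)%:R `^ 1.
  by near: n; apply: (@near_tower_l (fun k => 1 <= phi k * k%:R `^ 1)); apply: (sv ltr01).1.
have l0 : (0 < l n)%N by apply: leq_ltn_trans (tower_gt tw n).
have phi0 : 0 <= phi (l n).
  by rewrite -(pmulr_lge0 _ (powR_nat_gt0 1 l0)); apply: le_trans phi1.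
apply: le_trans wt _; apply: ler_wpM2r => //; rewrite lerD2l mulrC -ler_pdivlMr //.
by near: n; apply: near_natSinv_le; rewrite divr_gt0.
Unshelve. all: by end_near. Qed.

(** A new element has degree at least l n, so passing from gamma to g multiplies its weighted height
    by at least (l n)^(g - gamma), which outgrows 1 / phi. *)
Lemma tower_northcott_gt (g : R) : gamma < g -> northcott g L.
Proof.
move=> gg C C0; have d0 : 0 < g - gamma by rewrite subr_gt0.
have h2 : 0 < 1 / 2 :> R by rewrite divr_gt0.
apply: finite_small_height; near=> n => a Fa nFa.
have [phi0 Hn] : 0 <= phi (l n) /\ forall a, F n.+1 a -> ~ F n a ->
    (l n <= deg a)%N /\ (1 - 1 / 2) * phi (l n) <= wheight gamma a.
  by near: n; apply: near_wheight_new.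
have [la wa] := Hn a Fa nFa.
have K : C * 2 <= phi (l n) * (l n)%:R `^ (g - gamma).
  by near: n; apply: (@near_tower_l (fun k => C * 2 <= phi k * k%:R `^ (g - gamma))); apply: (sv d0).1.
have l0 : (0 < l n)%N by apply: leq_ltn_trans (tower_gt tw n).
rewrite wheightE.
apply: le_trans (_ : (l n)%:R `^ (g - gamma) * ((1 - 1 / 2) * phi (l n)) <= _); last first.
  apply: ler_pM => //; rewrite ?powR_ge0 //; last by apply: ler_powR_nat => //; apply: ltW.
  by rewrite mulr_ge0 //; lra.
set X := (l n)%:R `^ _ in K *; lra.
Unshelve. all: by end_near. Qed.

Lemma not_bogomolov_of_infinite (g : R) :
  (forall C : R, 0 < C -> \forall n \near \oo, wheight g (t n) < C) -> ~ bogomolov g L.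
Proof.
by move=> H [C C0]; apply: infinite_small_height; apply: H.
Qed.

(** Passing from gamma to g divides the weighted height of a test element by at least (l n)^(gamma -
    g), which outgrows phi. *)
Lemma tower_not_bogomolov_lt (g : R) : g < gamma -> ~ bogomolov g L.
Proof.
move=> gg; have d0 : 0 < gamma - g by rewrite subr_gt0.
apply: not_bogomolov_of_infinite => C C0; have C40 : 0 < C / 4 by rewrite divr_gt0.
near=> n.
have wt : wheight gamma (t n) <= (1 + 1) * phi (l n) by near: n; apply: near_wheight_test.
have K : phi (l n) <= C / 4 * (l n)%:R `^ (gamma - g).
  by near: n; apply: (@near_tower_l (fun k => phi k <= C / 4 * k%:R `^ (gamma - g))); apply: (sv d0).2.
have l0 : (0 < l n)%N by apply: leq_ltn_trans (tower_gt tw n).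
have [_ _ la _] := tower_test tw n; have d1 := deg_gt0 (t n).
have X0 : 0 < (deg (t n))%:R `^ (gamma - g) :> R by apply: powR_nat_gt0.
have XX := ler_powR_nat l0 la (ltW d0).
rewrite wheightE -opprB -(ltr_pM2l X0) mulrA -powR_natD // subrr powRr0 mul1r.
move: wt K X0 XX; set X := (deg _)%:R `^ _; set Y := (l n)%:R `^ _; nra.
Unshelve. all: by end_near. Qed.

Lemma northcott_bogomolov (g : R) : northcott g L -> bogomolov g L.
Proof.
move=> NL; exists 1 => //; apply: sub_finite_set (NL 1 ltr01) => a [[La _] wa].
by split.
Qed.

Lemma I_N_tower : northcott gamma L -> I_N L = `[gamma, +oo[%classic.
Proof.
move=> NL; apply/seteqP; split=> g /=; rewrite in_itv /= andbT.
  by rewrite leNgt => Ng; apply/negP => /tower_not_bogomolov_lt; apply; apply: northcott_bogomolov.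
by rewrite le_eqVlt => /predU1P[<-//|]; apply: tower_northcott_gt.
Qed.

Lemma I_B_tower : bogomolov gamma L -> I_B L = `[gamma, +oo[%classic.
Proof.
move=> BL; apply/seteqP; split=> g /=; rewrite in_itv /= andbT.
  by rewrite leNgt => Bg; apply/negP => /tower_not_bogomolov_lt.
rewrite le_eqVlt => /predU1P[<-//|gg]; apply: northcott_bogomolov.
exact: tower_northcott_gt.
Qed.

Lemma I_N_tower_open : ~ northcott gamma L -> I_N L = `]gamma, +oo[%classic.
Proof.
move=> NL; apply/seteqP; split=> g /=; rewrite in_itv /= andbT; last exact: tower_northcott_gt.
move=> Ng; rewrite ltNge le_eqVlt; apply/negP => /predU1P[gE|].
  by apply: NL; rewrite -gE.
by move=> /tower_not_bogomolov_lt; apply; apply: northcott_bogomolov.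
Qed.

Lemma I_B_tower_open : ~ bogomolov gamma L -> I_B L = `]gamma, +oo[%classic.
Proof.
move=> BL; apply/seteqP; split=> g /=; rewrite in_itv /= andbT; last first.
  by move=> gg; apply: northcott_bogomolov; apply: tower_northcott_gt.
move=> Bg; rewrite ltNge le_eqVlt; apply/negP => /predU1P[gE|].
  by apply: BL; rewrite -gE.
by move=> /tower_not_bogomolov_lt.
Qed.

End TowerUnion.

(** * The three growth functions and the theorem *)

Lemma slowly_varying_cst (R : realType) (c : R) : 0 < c -> slowly_varying (fun=> c).
Proof.
move=> c0 d d0; split=> [K|e e0].
  by apply: filterS (near_powR_ge (K / c) d0) => n; rewrite ler_pdivrMr // mulrC.
by apply: filterS (near_powR_ge (c / e) d0) => n; rewrite ler_pdivrMr // mulrC.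
Qed.

Lemma near_ln_ge (R : realType) (K : R) : \forall n \near \oo, K <= ln n%:R.
Proof.
have : \forall n \near \oo, expR K <= n%:R `^ 1 by apply: near_powR_ge.
apply: filterS => n; rewrite powRr1 // => h.
have n0 : 0 < n%:R :> R by apply: lt_le_trans h; apply: expR_gt0.
by rewrite -[K]expRK ler_ln ?posrE ?expR_gt0.
Qed.

Lemma slowly_varying_ln (R : realType) : slowly_varying (fun n => ln n%:R : R).
Proof.
move=> d d0; split=> [K|e e0]; last exact: near_ln_le.
near=> n; have h1 : `|K| <= n%:R `^ d by near: n; apply: near_powR_ge.
have h2 : 1 <= ln n%:R :> R by near: n; apply: near_ln_ge.
apply: le_trans (ler_norm K) _; apply: le_trans h1 _.
by rewrite -[leLHS]mul1r ler_wpM2r // powR_ge0.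
Unshelve. all: by end_near. Qed.

Lemma slowly_varying_inv_ln (R : realType) : slowly_varying (fun n => (ln n%:R : R)^-1).
Proof.
move=> d d0; split=> [K|e e0]; near=> n.
  have h2 : 1 <= ln n%:R :> R by near: n; apply: near_ln_ge.
  have ln0 : 0 < ln n%:R :> R by apply: lt_le_trans h2.
  have K0 : 0 < `|K| + 1 by rewrite ltr_wpDl.
  have h1 : ln n%:R <= (`|K| + 1)^-1 * n%:R `^ d by near: n; apply: near_ln_le; rewrite ?invr_gt0 ?ltr_wpDl.
  rewrite mulrC ler_pdivlMr //; apply: le_trans (_ : (`|K| + 1) * ln n%:R <= _).
    by rewrite ler_wpM2r ?(ltW ln0) // (le_trans (ler_norm K)) // lerDl.
  by rewrite mulrC -ler_pdivlMr // mulrC.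
have h2 : 1 <= ln n%:R :> R by near: n; apply: near_ln_ge.
have h1 : e^-1 <= n%:R `^ d by near: n; apply: near_powR_ge.
apply: le_trans (_ : 1 <= _); first by rewrite invf_le1 // (lt_le_trans ltr01).
by rewrite mulrC -ler_pdivrMr // mul1r.
Unshelve. all: by end_near. Qed.

Theorem theorem1p4 (R : realType) (gamma : R) (gamma_lt1 : gamma < 1) :
  [/\ exists L : set algC,
        [/\ subfield L, I_N L = `[gamma, +oo[%classic & I_B L = `[gamma, +oo[%classic],
      forall c : R, 0 < c ->
        exists L : set algC,
          [/\ subfield L,
              I_N L = `]gamma, +oo[%classic,
              `]gamma, +oo[%classic `<` `[gamma, +oo[%classic,
              I_B L = `[gamma, +oo[%classic &
              northcott_number gamma L = c%:E]
    & exists L : set algC,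
        [/\ subfield L, I_N L = `]gamma, +oo[%classic & I_B L = `]gamma, +oo[%classic]].
Proof.
split.
- have sv := @slowly_varying_ln R.
  have [F [l [t tw]]] := exists_weighted_tower gamma_lt1 sv.
  have NL : northcott gamma [set a | exists n, F n a].
    move=> C C0; have h2 : 0 < 1 / 2 :> R by rewrite divr_gt0.
    apply: (finite_small_height tw); near=> n => a Fa nFa.
    have [_ Hn] : 0 <= ln (l n)%:R :> R /\ forall a, F n.+1 a -> ~ F n a ->
        (l n <= deg a)%N /\ (1 - 1 / 2) * ln (l n)%:R <= wheight gamma a.
      by near: n; apply: (near_wheight_new tw sv).
    have [_ wa] := Hn a Fa nFa.
    have K : C * 2 <= ln (l n)%:R.
      by near: n; apply: (@near_tower_l _ _ _ _ _ _ tw (fun k => C * 2 <= ln k%:R)); apply: near_ln_ge.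
    by apply: le_trans wa; lra.
  exists [set a | exists n, F n a]; split; first exact: tower_union_subfield tw.
    exact: I_N_tower tw sv NL.
  by apply: (I_B_tower tw sv); apply: northcott_bogomolov.
- move=> c c0; have sv := slowly_varying_cst c0.
  have [F [l [t tw]]] := exists_weighted_tower gamma_lt1 sv.
  set L := [set a | exists n, F n a].
  have fin C : C < c -> finite_set (small_height gamma L C).
    (* This error e satisfies (1 - e) c = C. *)
    move=> Cc; have e0 : 0 < (c - C) / c by rewrite divr_gt0 // subr_gt0.
    apply: (finite_small_height tw); near=> n => a Fa nFa.
    have [_ Hn] : 0 <= c /\ forall a, F n.+1 a -> ~ F n a ->
        (l n <= deg a)%N /\ (1 - (c - C) / c) * c <= wheight gamma a.
      by near: n; apply: (near_wheight_new tw sv).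
    have [_ wa] := Hn a Fa nFa; apply: le_trans wa.
    by rewrite mulrBl divfK ?gt_eqF // mul1r subKr.
  have inf C : c < C -> infinite_set (small_height gamma (L `\` roots_of_unity L) C).
    (* With this error e, (1 + e) c is the midpoint of c and C. *)
    move=> cC; have e0 : 0 < (C - c) / (2 * c) by rewrite divr_gt0 ?mulr_gt0 // subr_gt0.
    apply: (infinite_small_height tw); near=> n.
    have wt : wheight gamma (t n) <= (1 + (C - c) / (2 * c)) * c.
      by near: n; apply: (near_wheight_test tw sv).
    apply: le_lt_trans wt _.
    have -> : (1 + (C - c) / (2 * c)) * c = c + (C - c) / 2 by field; rewrite gt_eqF.
    by lra.
  have infL C : c < C -> infinite_set (small_height gamma L C).
    move=> /inf iC fC; apply: iC; apply: sub_finite_set fC => a [[La _] wa].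
    by split.
  exists L; split.
  + exact: tower_union_subfield tw.
  + apply: (I_N_tower_open tw sv) => NL; apply: (infL (c + 1)); first by rewrite ltrDl.
    by apply: NL; rewrite addr_gt0.
  + split; first by move=> g /=; rewrite !in_itv /= !andbT => /ltW.
    by move=> /(_ gamma); rewrite /= !in_itv /= !andbT lexx ltxx => /(_ isT).
  + apply: (I_B_tower tw sv); exists (c / 2); first by rewrite divr_gt0.
    apply: sub_finite_set (fin (c / 2) _) => [a [[La _] wa] //|]; lra.
  + apply/eqP; rewrite eq_le; apply/andP; split.
      apply/lee_addgt0Pr => e e0; apply: ereal_inf_lbound => /=.
      exists (c + e); last by rewrite EFinD.
      by split; [rewrite addr_gt0 | apply: infL; rewrite ltrDl].
    apply: le_ereal_inf_tmp => _ [C [C0 iC] <-]; rewrite lee_fin leNgt; apply/negP => Cc.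
    exact: iC (fin C Cc).
- have sv := @slowly_varying_inv_ln R.
  have [F [l [t tw]]] := exists_weighted_tower gamma_lt1 sv.
  have BL : ~ bogomolov gamma [set a | exists n, F n a].
    apply: (not_bogomolov_of_infinite tw) => C C0; near=> n.
    have wt : wheight gamma (t n) <= (1 + 1) * (ln (l n)%:R)^-1.
      by near: n; apply: (near_wheight_test tw sv).
    have K : 4 / C <= ln (l n)%:R.
      by near: n; apply: (@near_tower_l _ _ _ _ _ _ tw (fun k => 4 / C <= ln k%:R)); apply: near_ln_ge.
    apply: le_lt_trans wt _.
    have C4 : 0 < 4 / C by rewrite divr_gt0.
    have ln0 : 0 < ln (l n)%:R :> R by apply: lt_le_trans K.
    have : (ln (l n)%:R)^-1 <= C / 4 by rewrite -[leRHS]invf_div lef_pV2 ?posrE.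
    by lra.
  exists [set a | exists n, F n a]; split; first exact: tower_union_subfield tw.
    by apply: (I_N_tower_open tw sv) => NL; apply: BL; apply: northcott_bogomolov.
  exact: I_B_tower_open tw sv BL.
Unshelve. all: by end_near. Qed.
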